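(* Let $D=6$ and consider $T^*\mathbb{R}^6$ with coordinates $(x_1,\dots,x_6,p_1,\dots,p_6)$ and the Hamiltonian $H$ given by $$2H=\bigl(p_1-\tfrac12x_2p_3-x_1x_2p_4-\tfrac12x_1^2x_2p_6\bigr)^2+\bigl(p_2+\tfrac12x_1p_3+x_1x_2p_5\bigr)^2,$$ which is the Hamiltonian of the left-invariant sub-Riemannian structure on the parabolic $(2,3,5,6)$-distribution. Then for no degree $d\le 6$ does $H$ admit a final integral of degree $d$. That is, for each integer $1\le d\le 6$ there is no function of the form $$F=\sum_{|\tau|=d}a_\tau(x_1,x_2)\,p^\tau$$ with smooth coefficients $a_\tau$ such that $\{H,F\}=0$ and such that $H,p_3,p_4,p_5,p_6,F$ are functionally independent almost everywhere.
   Context: $\{\cdot,\cdot\}$ is the Poisson bracket of the canonical symplectic structure on $T^*\mathbb{R}^6$. For a multi-index $\tau=(\tau_1,\dots,\tau_6)$ of non-negative integers, $p^\tau=\prod_{i=1}^6p_i^{\tau_i}$ and $|\tau|=\sum_i\tau_i$. The parabolic $(2,3,5,6)$-distribution is the left-invariant rank 2 distribution $\Delta=\langle e_1,e_2\rangle$ on the simply connected 6-dimensional Carnot group $G\cong\mathbb{R}^6$ whose Lie algebra $\langle e_1,\dots,e_6\rangle$ has the nontrivial brackets $$[e_1,e_2]=e_3,\ [e_1,e_3]=e_4,\ [e_2,e_3]=e_5,\ [e_1,e_4]=e_6.$$ The left-invariant sub-Riemannian metric on $\Delta$ is the one with orthonormal frame $e_1,e_2$. Its Hamiltonian is $H=\frac12(\omega_1^2+\omega_2^2)$,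 where $\omega_i$ is the fiberwise linear function on $T^*G$ defined by the left-invariant vector field $e_i$. In suitable global coordinates $x_1,\dots,x_6$ on $G$ it takes the form displayed in the claim. The Hamiltonian does not depend on $x_3,\dots,x_6$, so $p_3,p_4,p_5,p_6$ are integrals. Together with $H$ they form an involutive family of 5 functionally independent integrals. A ''final integral of degree $d$'' is one more integral completing this family to a Liouville integrable one: a function $F$ on $T^*G$, smooth in the base variables and homogeneous polynomial of degree $d$ in the momenta, which Poisson-commutes with $H,p_3,\dots,p_6$ and is such that $H,p_3,\dots,p_6,F$ are functionally independent almost everywhere. Commuting with $p_3,\dots,p_6$ means precisely that the coefficients of $F$ depend on $x_1,x_2$ only. *)

(* Defs.v *)
From HB Require Import structures.
From mathcomp Require Import all_boot all_order all_algebra.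
From mathcomp Require Import all_classical all_reals all_analysis.
Set Implicit Arguments.
Unset Strict Implicit.
Unset Printing Implicit Defensive.
Import Order.TTheory GRing.Theory Num.Theory.
Import numFieldNormedType.Exports.
Local Open Scope classical_set_scope.
Local Open Scope ring_scope.

Section Calculus.
Context {R : realType}.

Definition partial n (j : 'I_n) (f : 'rV[R]_n -> R) (z : 'rV[R]_n) : R :=
  'D_(delta_mx 0 j) f z.

Fixpoint Ck n (k : nat) (f : 'rV[R]_n -> R) : Prop :=
  match k with
  | 0 => continuous f
  | k'.+1 => forall j : 'I_n,
      (forall z, derivable f z (delta_mx 0 j)) /\ Ck k' (partial j f)
  end.

Definition smooth n (f : 'rV[R]_n -> R) : Prop := forall k, Ck k f.

(* The dimension is a successor because in dimension 0 every box, being a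
   product over the empty index set, would have volume 1. *)
Definition lebesgue_null n (A : set 'rV[R]_n.+1) : Prop :=
  forall e : R, 0 < e ->
  exists l u : nat -> 'rV[R]_n.+1,
    [/\ forall k i, l k 0 i <= u k 0 i,
        A `<=` \bigcup_k [set z : 'rV[R]_n.+1 | forall i, l k 0 i <= z 0 i <= u k 0 i] &
        (\sum_(0 <= k <oo) (\prod_i (u k 0 i - l k 0 i))%:E <= e%:E)%E].

(* Row i holds the components of the differential of [G i]. *)
Definition gradients n m (G : 'I_m -> 'rV[R]_n -> R) (z : 'rV[R]_n)
  : 'M[R]_(m, n) := \matrix_(i, j) partial j (G i) z.

Definition functionally_independent_ae n m (G : 'I_m -> 'rV[R]_n.+1 -> R)
  : Prop := lebesgue_null [set z : 'rV[R]_n.+1 | ~~ row_free (gradients G z)].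

(* A point of T^*R^n is a row vector whose first n entries are the positions
   x_1, ..., x_n and whose last n entries are the momenta p_1, ..., p_n. *)
Definition poisson n (f g : 'rV[R]_(n + n) -> R) (z : 'rV[R]_(n + n)) : R :=
  \sum_(i < n) (partial (rshift n i) f z * partial (lshift n i) g z
                - partial (lshift n i) f z * partial (rshift n i) g z).

End Calculus.

Section Parabolic2356.
Context {R : realType}.
Implicit Type z : 'rV[R]_(6 + 6).

(* [xc k] and [pc k] are meant for k = 1, ..., 6. *)
Definition xc (k : nat) z : R := z 0 (lshift 6 (inord k.-1)).
Definition pc (k : nat) z : R := z 0 (rshift 6 (inord k.-1)).

(* Fiberwise linear functions of the left-invariant fields
     e_1 = d_1 - (x_2/2) d_3 - x_1 x_2 d_4 - (x_1^2 x_2 / 2) d_6,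
     e_2 = d_2 + (x_1/2) d_3 + x_1 x_2 d_5,
   for which [e_1,e_2] = e_3 = d_3 + x_1 d_4 + x_2 d_5 + (x_1^2/2) d_6,
   [e_1,e_3] = e_4 = d_4 + x_1 d_6, [e_2,e_3] = e_5 = d_5 and
   [e_1,e_4] = e_6 = d_6 are the only nonzero brackets. *)
Definition omega1 z : R :=
  pc 1 z - 2^-1 * xc 2 z * pc 3 z - xc 1 z * xc 2 z * pc 4 z
  - 2^-1 * xc 1 z ^+ 2 * xc 2 z * pc 6 z.
Definition omega2 z : R :=
  pc 2 z + 2^-1 * xc 1 z * pc 3 z + xc 1 z * xc 2 z * pc 5 z.

Definition H z : R := 2^-1 * (omega1 z ^+ 2 + omega2 z ^+ 2).

(* The entries of a multi-index of length d are at most d, whence the finite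
   type of multi-indices; only those with |t| = d enter the sum. *)
Definition multiindex (d : nat) := {ffun 'I_6 -> 'I_d.+1}.
Definition mlength d (t : multiindex d) : nat := (\sum_i t i)%N.

Definition mom_monomial d (t : multiindex d) z : R :=
  \prod_(i < 6) pc i.+1 z ^+ t i.

Definition hom_in_momenta d (a : multiindex d -> 'rV[R]_2 -> R) z : R :=
  \sum_(t : multiindex d | mlength t == d)
     a t (\row_(i < 2) xc i.+1 z) * mom_monomial t z.

Definition final_integral (d : nat) (F : 'rV[R]_(6 + 6) -> R) : Prop :=
  [/\ exists a : multiindex d -> 'rV[R]_2 -> R,
        (forall t, mlength t = d -> smooth (a t)) /\
        (forall z, F z = hom_in_momenta a z),
      forall z, poisson H F z = 0 &
      functionally_independent_ae (n := 11)
        (tnth [tuple H; pc 3; pc 4; pc 5; pc 6; F])].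

End Parabolic2356.

(* Main.v *)
Require Import Defs.
From mathcomp Require Import all_boot all_order all_algebra.
From mathcomp Require Import all_classical all_reals all_analysis.
From mathcomp Require Import measurable_realfun zify ring lra.
Set Implicit Arguments.
Unset Strict Implicit.
Unset Printing Implicit Defensive.
Import Order.TTheory GRing.Theory Num.Theory.
Import numFieldNormedType.Exports.
Local Open Scope ring_scope.

(** Fix generic values of p3, p4, p5 and let e stand for p6.  On the plane
    with coordinates (x, y) = (x1, x2) and velocity (u, v) = (omega1, omega2),
    H is the Hamiltonian of a particle in the magnetic field
    B = p3 + p4 x + p5 y + e x^2 / 2.  Comparing coefficients of the momenta in
    {H, F} = 0, from the highest degree downwards, shows that an integral F is
    polynomial in x and y.  Expand it in powers of e on a level u^2 + v^2 = h.
    For e = 0 the field b = p3 + p4 x + p5 y is linear, and in terms of b, of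
    the coordinate s transverse to it and of the rotated velocity (U, V) the
    motion is b' = V, s' = U, U' = - b V, V' = b U, whose polynomial integrals
    are the polynomials in E = b^2 / 2 + U (compare degrees in s and b).  If
    phi(E) is the first nonconstant coefficient of the expansion, the next one
    is a primitive of phi'(E) V x^2 / 2; but V x^2 / 2 is a derivative plus a
    nonzero multiple of p4 p5 h, so phi' = 0.  Hence F is constant on each
    level of H, p3, ..., p6; evaluating it at the origin of the plane makes it
    locally a polynomial in these functions, and its differential is a
    combination of theirs on an open set that contains a cube. *)

(** * Derivations and representations by pairs *)

(** No trajectory is ever constructed. On a level, [V] is a square root of a polynomial in b and E,
    so a function polynomial in position and velocity is a pair [P + Q V] of polynomials, and the
    flow acts on such pairs by an explicit formula. A relation between a function and its
    derivative, stable under sums and products, carries F through this formula, and the vanishing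
    bracket becomes the vanishing of a pair. Passing from vanishing at the real points of a level to
    vanishing of polynomials requires enough such points and both signs of [V].

    The parameter e is kept as one more polynomial variable, the outermost one. The expansion in
    powers of e is then a finite comparison of coefficients, and no convergence question arises.
    Polynomiality in x and y has to be proved beforehand because the coefficients of F are only
    smooth; it is what makes a degree argument available at all. *)

Lemma derivation1 (T : comNzRingType) (d : T -> T) :
  (forall x y, d (x * y) = d x * y + x * d y) -> d 1 = 0.
Proof.
move=> dM; have /eqP := dM 1 1.
by rewrite !mulr1 mul1r addrC -subr_eq subrr eq_sym => /eqP.
Qed.

Section MapDerivation.
Variables (S : comNzRingType) (d : S -> S).
Hypothesis d_add : {morph d : x y / x + y}.
Hypothesis d_leibniz : forall x y, d (x * y) = d x * y + x * d y.

Lemma derivation0 : d 0 = 0.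
Proof. by apply: (addrI (d 0)); rewrite -d_add !addr0. Qed.

Lemma coef_map_derivation p i : (map_poly d p)`_i = d p`_i.
Proof. exact/coef_map_id0/derivation0. Qed.

Lemma map_derivationD : {morph map_poly d : p q / p + q}.
Proof. by move=> p q; apply/polyP => i; rewrite !(coef_map_derivation, coefD). Qed.

Lemma map_derivationM p q :
  map_poly d (p * q) = map_poly d p * q + p * map_poly d q.
Proof.
have d_sum (I : Type) (r : seq I) (F : I -> S) :
  d (\sum_(i <- r) F i) = \sum_(i <- r) d (F i).
  exact: (big_morph d d_add derivation0).
apply/polyP => i; rewrite !(coef_map_derivation, coefD, coefM) d_sum -big_split.
by apply: eq_bigr => j _; rewrite !coef_map_derivation.
Qed.

End MapDerivation.

(* [rep f g] is meant as: f has a finite algebraic description on the valid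
   points, and g is its derivative along a flow. *)
Record derivation_rep (R : comNzRingType) (pt : Type) (valid : pt -> Prop)
    (rep : (pt -> R) -> (pt -> R) -> Prop) : Prop := DerivationRep {
  rep_eq : forall f g f' g', (forall z, valid z -> f z = f' z) ->
    (forall z, valid z -> g z = g' z) -> rep f g -> rep f' g';
  rep_cst : forall c, rep (fun=> c) (fun=> 0);
  repD : forall f g f' g', rep f g -> rep f' g' ->
    rep (fun z => f z + f' z) (fun z => g z + g' z);
  repM : forall f g f' g', rep f g -> rep f' g' ->
    rep (fun z => f z * f' z) (fun z => g z * f' z + f z * g' z)
}.

Section DerivationRep.
Variables (R : comNzRingType) (pt : Type) (valid : pt -> Prop).
Variable rep : (pt -> R) -> (pt -> R) -> Prop.
Hypothesis repP : derivation_rep valid rep.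

Lemma rep_sum (I : Type) (r : seq I) (p : pred I) (f g : I -> pt -> R) :
  (forall i, p i -> rep (f i) (g i)) ->
  rep (fun z => \sum_(i <- r | p i) f i z) (fun z => \sum_(i <- r | p i) g i z).
Proof.
move=> H; elim: r => [|i r IH].
  by apply: (rep_eq repP) (rep_cst repP 0) => z _; rewrite big_nil.
case pi: (p i).
  by apply: (rep_eq repP) (repD repP (H i pi) IH) => z _; rewrite big_cons pi.
by apply: (rep_eq repP) IH => z _; rewrite big_cons pi.
Qed.

Lemma rep_exp f g n : rep f g ->
  rep (fun z => f z ^+ n) (fun z => f z ^+ n.-1 * g z *+ n).
Proof.
move=> H; elim: n => [|n IH]; first by apply: (rep_eq repP) (rep_cst repP 1).
apply: (rep_eq repP) (repM repP H IH) => z _ /=; first by rewrite exprS.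
case: n IH => [|n] _ /=; first by rewrite mulr0n mulr0 addr0 expr0 mulr1 mul1r mulr1n.
by rewrite [in RHS]mulrS mulrnAr mulrA -exprS [g z * _]mulrC.
Qed.

Lemma repZ c f g : rep f g -> rep (fun z => c * f z) (fun z => c * g z).
Proof.
move=> H; apply: (rep_eq repP) (repM repP (rep_cst repP c) H) => // z _.
by rewrite mul0r add0r.
Qed.

End DerivationRep.

(** * Functions on a level as pairs P + Q V *)

Section LevelPairs.
Variables (T R : comNzRingType) (ds db dE : T -> T).
Hypothesis ds_add : {morph ds : x y / x + y}.
Hypothesis ds_leibniz : forall x y, ds (x * y) = ds x * y + x * ds y.
Hypothesis db_add : {morph db : x y / x + y}.
Hypothesis db_leibniz : forall x y, db (x * y) = db x * y + x * db y.
Hypothesis dE_add : {morph dE : x y / x + y}.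
Hypothesis dE_leibniz : forall x y, dE (x * y) = dE x * y + x * dE y.
Variables (U N b w : T).
Hypotheses (dsN : ds N = 0) (dbN : db N = 2 * b * U) (dEN : dE N = - (2 * U)).
Variables (pt : Type) (valid : pt -> Prop).
Variables (phi : pt -> {rmorphism T -> R}) (V : pt -> R).
Hypothesis V2 : forall z, valid z -> V z ^+ 2 = phi z N.

(** With w = e x^2 the rules of the flow are s' = U, b' = V, E' = - w V / 2 and V' = (b + w / 2) U.
    The two components come from differentiating [P + Q V] by these rules and replacing V^2 by
    [N]. *)
Definition pair_flow1 (P Q : T) : T :=
  2 * (U * ds P + N * db Q + b * U * Q) + w * (U * Q - N * dE Q).
Definition pair_flow2 (P Q : T) : T := 2 * (db P + U * ds Q) - w * dE P.
Definition pair_eval (P Q : T) (z : pt) : R := phi z P + V z * phi z Q.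

(* Both derivatives are doubled, which avoids halves in T. *)
Definition flow_pair (f g : pt -> R) : Prop := exists P Q, forall z, valid z ->
  f z = pair_eval P Q z /\ 2 * g z = pair_eval (pair_flow1 P Q) (pair_flow2 P Q) z.

Lemma flow_pairD f g f' g' : flow_pair f g -> flow_pair f' g' ->
  flow_pair (fun z => f z + f' z) (fun z => g z + g' z).
Proof.
move=> [P [Q H]] [P' [Q' H']]; exists (P + P'), (Q + Q') => z vz.
have [-> e] := H z vz; have [-> e'] := H' z vz; split.
  by rewrite /pair_eval !rmorphD; ring.
rewrite mulrDr e e' /pair_eval /pair_flow1 /pair_flow2 !(ds_add, db_add, dE_add).
by rewrite !(rmorphD, rmorphM, rmorphB, rmorph1); ring.
Qed.

(** The hypotheses on the derivatives of [N] amount to N' = 2 V V' along the flow. Hence the flow is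
    compatible with the relation V^2 = N and obeys the Leibniz rule on pairs. *)
Lemma flow_pairM f g f' g' : flow_pair f g -> flow_pair f' g' ->
  flow_pair (fun z => f z * f' z) (fun z => g z * f' z + f z * g' z).
Proof.
move=> [P [Q H]] [P' [Q' H']].
exists (P * P' + N * Q * Q'), (P * Q' + Q * P') => z vz.
have [ef e] := H z vz; have [ef' e'] := H' z vz; split.
  rewrite ef ef' /pair_eval !(rmorphD, rmorphM) -(V2 vz); ring.
rewrite mulrDr mulrA e [2 * (f z * _)]mulrCA e' ef ef'.
rewrite /pair_eval /pair_flow1 /pair_flow2.
rewrite !(ds_add, db_add, dE_add, ds_leibniz, db_leibniz, dE_leibniz) dsN dbN dEN.
rewrite !(rmorphD, rmorphM, rmorphB, rmorphN, rmorph1, rmorph0) -(V2 vz).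
ring.
Qed.

Lemma flow_pair_stationary f P : ds P = 0 -> db P = 0 -> dE P = 0 ->
  (forall z, f z = phi z P) -> flow_pair f (fun=> 0).
Proof.
move=> sP bP EP ef; exists P, 0 => z _.
rewrite ef /pair_eval /pair_flow1 /pair_flow2 sP bP EP.
rewrite (derivation0 ds_add) (derivation0 db_add) (derivation0 dE_add).
by rewrite !(mulr0, addr0, subr0, rmorph0).
Qed.

Lemma flow_pair_even P a c e f g : ds P = a -> db P = c -> dE P = e ->
  (forall z, f z = phi z P) ->
  (forall z, 2 * g z = 2 * (phi z U * phi z a)
     + V z * (2 * phi z c - phi z w * phi z e)) ->
  flow_pair f g.
Proof.
move=> sP bP EP ef eg; exists P, 0 => z _.
rewrite ef eg /pair_eval /pair_flow1 /pair_flow2 sP bP EP.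
rewrite (derivation0 ds_add) (derivation0 db_add) (derivation0 dE_add).
rewrite !(mulr0, addr0, subr0, rmorph0) !(rmorphM, rmorphB, rmorphD, rmorph1).
by split.
Qed.

Lemma flow_pair_V g :
  (forall z, 2 * g z = (2 * phi z b + phi z w) * phi z U) -> flow_pair V g.
Proof.
move=> eg; exists 0, 1 => z _.
rewrite eg /pair_eval /pair_flow1 /pair_flow2.
rewrite (derivation0 ds_add) (derivation0 db_add) (derivation0 dE_add).
rewrite (derivation1 ds_leibniz) (derivation1 db_leibniz) (derivation1 dE_leibniz).
rewrite !(mulr0, addr0, subr0, add0r, mulr1, rmorph0) !(rmorphM, rmorphB, rmorphD, rmorph1).
by split; ring.
Qed.

Lemma flow_pair_derivation_rep :
  (forall c, flow_pair (fun=> c) (fun=> 0)) -> derivation_rep valid flow_pair.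
Proof.
move=> cst; split; [|exact: cst|exact: flow_pairD|exact: flow_pairM].
move=> f g f' g' ef eg [P [Q H]]; exists P, Q => z vz.
by rewrite -ef // -eg //; exact: H.
Qed.

End LevelPairs.

(** * Integrating the quadratic perturbation along the linear flow *)

Section PrimitiveField.
Variables (T : comNzRingType) (ds db : T -> T).
Hypothesis ds_add : {morph ds : x y / x + y}.
Hypothesis ds_leibniz : forall x y, ds (x * y) = ds x * y + x * ds y.
Hypothesis db_add : {morph db : x y / x + y}.
Hypothesis db_leibniz : forall x y, db (x * y) = db x * y + x * db y.
Variables (hf be ga si k b E s : T).
Hypothesis hf2 : 2 * hf = 1.
Hypothesis ds_cst : (ds be = 0) * (ds ga = 0) * (ds si = 0) * (ds E = 0) * (ds b = 0).
Hypothesis db_cst : (db be = 0) * (db ga = 0) * (db si = 0) * (db E = 0) * (db s = 0).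
Hypotheses (ds_s : ds s = 1) (db_b : db b = 1).

Let U := E - hf * b ^+ 2.

Let D1 P Q := U * ds P + (k - U ^+ 2) * db Q + b * U * Q.
Let D2 P Q := db P + U * ds Q.

(** Integrate x^2 V by parts using V = b', U = s' and b U = V'. Every monomial of x^2 integrates
    exactly except the cross term b s: it leads to U^2, and (b V)' = k + 2 E U - 3 U^2 leaves the
    constant [k] behind, with factor [be * si]. *)
Lemma quadratic_field_primitive (P Q f : T) :
  ds f = 0 -> db f = 0 ->
  D1 P Q = 0 -> 2 * D2 P Q = f * (be * b + ga + si * s) ^+ 2 ->
  exists P' Q', D1 P' Q' = f * (be * si * k *+ 2) /\ D2 P' Q' = 0.
Proof.
move=> dsf dbf e1 e2.
have hf0 : 0 = 1 - 2 * hf by rewrite hf2 subrr.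
have ds0 := derivation0 ds_add; have db0 := derivation0 db_add.
have dsN x : ds (- x) = - ds x.
  by apply/eqP; rewrite -addr_eq0 -ds_add addNr ds0.
have dbN x : db (- x) = - db x.
  by apply/eqP; rewrite -addr_eq0 -db_add addNr db0.
have dsn n x : ds (x *+ n) = ds x *+ n.
  by elim: n => [|n IH]; rewrite ?mulr0n // !mulrS ds_add IH.
have dbn n x : db (x *+ n) = db x *+ n.
  by elim: n => [|n IH]; rewrite ?mulr0n // !mulrS db_add IH.
have rules := (ds_add, ds_leibniz, dsN, dsn, db_add, db_leibniz, dbN, dbn).
(* Up to a constant, W1 + W2 V is a primitive of 3 x^2 V along the flow. *)
pose W1 := be * be * b * b * b + ga * ga * b *+ 3 + be * ga * b * b *+ 3
    + ga * si * s * b *+ 6 + si * si * (s * s * b *+ 3 + E * b *+ 6 - b * b * b)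
    + be * si * (s * b * b *+ 3 - E * s *+ 2).
pose W2 := - (ga * si *+ 6 + si * si * s *+ 6 + be * si * b *+ 2).
have w1 : D1 W1 W2 = - (be * si * k *+ 2).
  apply/eqP; rewrite -subr_eq0; apply/eqP.
  rewrite /D1 /W1 /W2 !rules !(ds_cst, db_cst, ds_s, db_b) /U.
  rewrite -[RHS](mul0r (be * si * (E - hf * b ^+ 2) * b ^+ 2)) [X in _ = X * _]hf0; ring.
have w2 : D2 W1 W2 = 3 * (be * b + ga + si * s) ^+ 2.
  apply/eqP; rewrite -subr_eq0; apply/eqP.
  rewrite /D2 /W1 /W2 !rules !(ds_cst, db_cst, ds_s, db_b) /U.
  rewrite -[RHS](mul0r (- (si * si * b ^+ 2 *+ 3))) [X in _ = X * _]hf0; ring.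
(* Twice the derivative of [P + Q V] is f x^2 V, and that of [W1 + W2 V] is 3 x^2 V minus the
   constant; this combination cancels x^2 V. *)
exists (P *+ 6 - f * W1), (Q *+ 6 - f * W2); split.
  rewrite [LHS](_ : _ = 6 * D1 P Q - f * D1 W1 W2); first by rewrite e1 w1; ring.
  by rewrite /D1 !rules dsf dbf; ring.
rewrite [LHS](_ : _ = 3 * (2 * D2 P Q) - f * D2 W1 W2); first by rewrite e2 w2; ring.
by rewrite /D2 !rules dsf dbf; ring.
Qed.

End PrimitiveField.

(** * The linear magnetic field on a fixed level *)

Section MagneticLevel.
Context {R : rcfType}.
Variable h : R.

(* Variables, from the inside out: the energy E, the field b, and the
   transverse coordinate s. *)
Local Notation S1 := {poly R}.
Local Notation S2 := {poly S1}.
Local Notation S3 := {poly S2}.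

(** Here ['X%:P] is E and ['X] is b: the velocity U is eliminated in favour of the energy E = b^2 /
    2 + U, which is constant along the linear flow. Then [lvN] is V^2 on the level U^2 + V^2 = h. *)
Definition lvU : S2 := 'X%:P - (2^-1 : R)%:P%:P * 'X^2.
Definition lvN : S2 := h%:P%:P - lvU ^+ 2.

Lemma lvN_expand : lvN =
  (h%:P - 'X^2)%:P + 'X%:P * 'X^2 - (4^-1 : R)%:P%:P * 'X^4.
Proof.
rewrite /lvN /lvU polyCB polyC_exp.
have -> : (4^-1 : R) = 2^-1 * 2^-1 by field.
have : (2^-1 : R)%:P%:P + (2^-1)%:P%:P = 1 :> S2.
  by rewrite -!polyCD (_ : _ + _ = 1) //; field.
rewrite !polyCM => e2; rewrite -['X%:P * 'X^2]mul1r -e2.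
by move: ('X : S2) => X; ring.
Qed.

(** If Q has degree m in b and leading coefficient q, the coefficient of b^(m+3) on the left is - (m
    + 2) q / 4, since both terms contribute with the same sign; the right side has degree at most
    2. *)
Lemma lv_ode_rigid (Q c : S2) : (size c <= 3)%N ->
  lvN * Q^`() + 'X * lvU * Q = c -> Q = 0.
Proof.
move=> sc eqc; apply/eqP/negP => /negP Q0.
set m := (size Q).-1.
have sQ : size Q = m.+1 by rewrite prednK // lt0n size_poly_eq0.
have big i : (m < i)%N -> Q`_i = 0 by move=> mi; rewrite nth_default // sQ.
have := congr1 (fun p : S2 => p`_(m.+3)) eqc.
rewrite (nth_default _ (leq_trans sc _)) //.
rewrite (_ : _ + _ = (h%:P - 'X^2)%:P * Q^`() + 'X%:P * ('X^2 * Q^`())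
   - (4^-1)%:P%:P * ('X^4 * Q^`())
   + ('X%:P * ('X * Q) - (2^-1)%:P%:P * ('X^3 * Q))); last first.
  rewrite lvN_expand /lvU.
  move: ('X : S2) => X; ring.
rewrite !(coefD, coefN, coefCM, coefXnM, coefXM) /=.
rewrite !coef_deriv !subSS !subn0 !(big m.+1, big m.+2, big m.+3, big m.+4) ?leqnSn //; try lia.
rewrite !mul0rn !mulr0 !add0r.
(* For m = 0 the derivative of Q contributes nothing, and the term b U Q alone gives the coefficient
   - q / 2. *)
have [m0|m0] := eqVneq m 0%N.
  rewrite m0 /= mulr0 oppr0 !add0r => /eqP.
  rewrite oppr_eq0 mulf_eq0 polyC_eq0 invr_eq0 pnatr_eq0 /= -m0.
  by rewrite -[Q`_m]/(lead_coef Q) lead_coef_eq0 (negPf Q0).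
have -> : (m.+3 < 4)%N = false by case: (m) m0.
have -> : (m - 1).+1 = m by rewrite subn1 prednK // lt0n.
move=> /eqP; rewrite -opprD oppr_eq0 -[Q`_m *+ m]mulr_natl mulrA -mulrDl mulf_eq0.
rewrite -[Q`_m]/(lead_coef Q) lead_coef_eq0 (negPf Q0) orbF.
rewrite -polyC_natr -polyCM -polyCD polyC_eq0.
by have : (0 : R) <= m%:R by []; lra.
Qed.

Definition lv_db : S3 -> S3 := map_poly (@deriv S1).
Definition lv_dE : S3 -> S3 := map_poly (map_poly (@deriv R)).

(* A pair (P, Q) stands for P + Q V, where V ^+ 2 = lvN; these are the two
   components of its derivative along the flow of the linear field:
   b' = V, s' = U, E' = 0, V' = b U. *)
Definition lvD1 (P Q : S3) : S3 :=
  lvU%:P * P^`() + lvN%:P * lv_db Q + 'X%:P * lvU%:P * Q.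
Definition lvD2 (P Q : S3) : S3 := lv_db P + lvU%:P * Q^`().

(* The rotation of the velocity: U' = - V, V' = U, E' = - V. *)
Definition lvRt1 (P Q : S3) : S3 := lvU%:P * Q - lvN%:P * lv_dE Q.
Definition lvRt2 (P Q : S3) : S3 := - lv_dE P.

Lemma deriv_eq0_polyC (T : idomainType) (p : {poly T}) :
  (forall n, n.+1%:R != 0 :> T) -> p^`() = 0 -> p = (p`_0)%:P.
Proof.
move=> cT dp; apply/polyP => -[|i]; rewrite coefC //=.
have /eqP := congr1 (fun q : {poly T} => q`_i) dp.
by rewrite coef_deriv coef0 -mulr_natl mulf_eq0 (negPf (cT i)) => /eqP.
Qed.

Lemma polyC_natS_neq0 n : n.+1%:R != 0 :> S1.
Proof. by rewrite -polyC_natr polyC_eq0 pnatr_eq0. Qed.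

Lemma lvU_coef2 : lvU`_2 = - (2^-1)%:P.
Proof. by rewrite /lvU coefB coefC coefCM coefXn eqxx mulr1 sub0r. Qed.

Lemma size_lvU : (size lvU <= 3)%N.
Proof.
rewrite (leq_trans (size_polyD _ _)) // geq_max size_polyN.
rewrite (leq_trans (size_polyC_leq1 _)) //=.
by rewrite mul_polyC (leq_trans (size_scale_leq _ _)) // size_polyXn.
Qed.

(** As P1 is free of b, U P1 has degree at most 2 in b, so [lv_ode_rigid] removes Q0. In the
    remaining equation (n + 1) U P1 = a the right side is free of b, whereas U contains - b^2 /
    2. *)
Lemma lv_top_coef (n : nat) (P1 Q0 a : S2) (c : S1) : (size a <= 1)%N ->
  P1 = c%:P -> lvN * Q0^`() + 'X * lvU * Q0 + lvU * (P1 *+ n.+1) = a ->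
  [/\ Q0 = 0, P1 = 0 & a = 0].
Proof.
move=> sa ->.
have -> : c%:P *+ n.+1 = (c *+ n.+1)%:P by rewrite polyCMn.
move=> e.
have Q00 : Q0 = 0.
  apply: (@lv_ode_rigid Q0 (a - lvU * (c *+ n.+1)%:P)); last first.
    by rewrite -e addrK.
  rewrite (leq_trans (size_polyD _ _)) // geq_max (leq_trans sa) //= size_polyN.
  rewrite mulrC mul_polyC (leq_trans (size_scale_leq _ _)) //.
  exact: size_lvU.
move: e; rewrite Q00 raddf0 !mulr0 !add0r => e.
have c0 : c = 0.
  have := congr1 (fun p : S2 => p`_2) e.
  rewrite /= [RHS]nth_default ?(leq_trans sa) // coefMC lvU_coef2 -[c *+ n.+1]mulr_natl => /eqP.
  rewrite !mulf_eq0 oppr_eq0 polyC_eq0 invr_eq0 pnatr_eq0 (negPf (polyC_natS_neq0 n)) /=.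
  by move/eqP.
by split => //; rewrite -?e c0 ?polyC0 ?mul0rn ?mulr0.
Qed.

(** Admitting a right-hand side [a] in E yields two facts at once: integrals of the linear field
    depend on E alone, and no nonzero polynomial in E is a derivative. The second one makes the
    constant left by the perturbation an obstruction. *)
Lemma lv_integral_rigid (P Q : S3) (a : S1) :
  lvD1 P Q = a%:P%:P -> lvD2 P Q = 0 ->
  [/\ a = 0, Q = 0 & exists f : S1, P = f%:P%:P].
Proof.
move=> e1 e2.
have c1 n : lvN * (Q`_n)^`() + 'X * lvU * Q`_n + lvU * (P`_n.+1 *+ n.+1)
            = (a%:P%:P : S3)`_n.
  rewrite -e1 /lvD1 !(coefD, coefCM) coef_deriv coef_map /=.
  by rewrite addrC addrA -polyCM coefCM.
have c2 n : (P`_n)^`() + lvU * (Q`_n.+1 *+ n.+1) = 0.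
  have := congr1 (fun p : S3 => p`_n) e2.
  by rewrite /lvD2 coefD coefCM coef_deriv coef_map coef0.
have sa n : (size ((a%:P%:P : S3)`_n)%R <= 1)%N.
  by rewrite coefC; case: eqP => _; rewrite ?size_poly0 ?size_polyC_leq1.
have cst p : p^`() = 0 -> p = (p`_0)%:P := @deriv_eq0_polyC S1 p polyC_natS_neq0.
(* Downward induction on the degree in s, with [k] bounding the distance to the top. If the
   coefficients of index n + 2 vanish, [c2] makes P_(n+1) free of b, [c1 n.+1] kills Q_(n+1), and
   [c1 n] kills P_(n+1). *)
have van k n : (maxn (size P) (size Q) <= n.+1 + k)%N ->
    P`_n.+1 = 0 /\ Q`_n.+1 = 0.
  elim: k n => [|k IH] n.
    by rewrite addn0 geq_max => /andP[sP sQ]; rewrite !nth_default.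
  rewrite addnS -addSn => /IH[P2 Q2].
  have := c2 n.+1; rewrite Q2 mul0rn mulr0 addr0 => /cst P1.
  have Q1 : Q`_n.+1 = 0.
    rewrite -polyC0 in P2; by have [] := lv_top_coef (sa _) P2 (c1 n.+1).
  by have [] := lv_top_coef (sa _) P1 (c1 n).
have vanS n : P`_n.+1 = 0 /\ Q`_n.+1 = 0.
  by apply: (van (maxn (size P) (size Q))); rewrite leq_addl.
have [P1 Q1] := vanS 0%N.
rewrite -polyC0 in P1; have [Q0 _ a0] := lv_top_coef (sa _) P1 (c1 0%N).
have := c2 0%N; rewrite Q1 mul0rn mulr0 addr0 => /cst P0.
split.
- by move/eqP: a0; rewrite coefC /= polyC_eq0 => /eqP.
- by apply/polyP => -[|n]; rewrite coef0 // (vanS n).2.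
exists (P`_0)`_0; rewrite -P0; apply/polyP => -[|n]; rewrite coefC //=.
exact: (vanS n).1.
Qed.

Lemma lv_dE_cst (f : S1) : lv_dE f%:P%:P = (f^`())%:P%:P.
Proof.
by rewrite /lv_dE map_polyC /= map_polyC.
Qed.

Variables (be ga si : R).

Definition lvx : S3 :=
  be%:P%:P%:P * 'X%:P + ga%:P%:P%:P + si%:P%:P%:P * 'X.

Lemma lv_dbD : {morph lv_db : p q / p + q}.
Proof. exact/map_derivationD/derivD. Qed.

Lemma lv_dbM p q : lv_db (p * q) = lv_db p * q + p * lv_db q.
Proof. by apply: map_derivationM; [exact: derivD|exact: derivM]. Qed.

Lemma lv_dbC (c : S2) : lv_db c%:P = (c^`())%:P.
Proof. by rewrite /lv_db map_polyC. Qed.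

Lemma lv_dbX : lv_db 'X = 0.
Proof.
apply/polyP => i; rewrite coef_map coefX coef0.
by case: eqP => _ /=; rewrite -?polyC1 ?derivC ?raddf0.
Qed.

Lemma double_polyC (x : R) : x + x = 1 -> 2 * x%:P%:P%:P = 1 :> S3.
Proof.
move=> e.
rewrite (mulr_natl x%:P%:P%:P 2) mulr2n -(polyCD x%:P%:P) -(polyCD x%:P).
by rewrite -(polyCD x) e !polyC1.
Qed.

Lemma lv_field_primitive (P Q : S3) (f : S1) :
  lvD1 P Q = 0 -> 2 * lvD2 P Q = f%:P%:P * lvx ^+ 2 ->
  exists P' Q' : S3,
    lvD1 P' Q' = (f * (be * si * h *+ 2)%:P)%:P%:P /\ lvD2 P' Q' = 0.
Proof.
have dsC (c : S2) : (c%:P)^`() = 0 :> S3 := derivC c.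
have dbC (x : S1) : lv_db x%:P%:P = 0 by rewrite lv_dbC derivC polyC0.
have dbX : lv_db ('X%:P) = 1 by rewrite lv_dbC derivX polyC1.
have dsX : ('X)^`() = 1 :> S3 := derivX _.
have hf2 : 2 * (2^-1 : R)%:P%:P%:P = 1 :> S3 by apply: double_polyC; field.
have := @quadratic_field_primitive S3 _ _ (@derivD S2) (@derivM S2)
  lv_dbD lv_dbM _ _ _ _ h%:P%:P%:P _ _ _ hf2
  (dsC be%:P%:P, dsC ga%:P%:P, dsC si%:P%:P, dsC 'X%:P, dsC 'X)
  (dbC be%:P, dbC ga%:P, dbC si%:P, dbC 'X, lv_dbX) dsX dbX P Q f%:P%:P
  (dsC f%:P) (dbC f).
clear hf2 dsC dbC dbX dsX.
rewrite -[_%:P - _ * _ ^+ 2](_ : lvU%:P = _); last first.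
  by rewrite /lvU polyCB polyCM !expr2 polyCM.
rewrite -[_%:P - _ ^+ 2](_ : lvN%:P = _); last first.
  by rewrite /lvN polyCB !expr2 polyCM.
move=> H e1 e2; have [P' [Q' [e3 e4]]] := H e1 e2.
exists P', Q'; split; last exact: e4.
by apply: (etrans e3) => {H e1 e2 e3 e4}; rewrite !polyCM !polyCMn !polyCM.
Qed.

Hypotheses (h0 : h != 0) (be0 : be != 0) (si0 : si != 0).

(** Otherwise f(E) times the nonzero constant [be * si * h *+ 2] would be a derivative along the
    linear flow. *)
Lemma lv_field_obstruction (P Q : S3) (f : S1) :
  lvD1 P Q = 0 -> 2 * lvD2 P Q = f%:P%:P * lvx ^+ 2 -> f = 0.
Proof.
move=> e1 e2; have [P' [Q' [d1 d2]]] := lv_field_primitive e1 e2.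
have [+ _ _] := lv_integral_rigid d1 d2.
move/eqP; rewrite mulf_eq0 polyC_eq0 mulrn_eq0 !mulf_eq0 (negPf h0) (negPf be0).
by rewrite (negPf si0) /= ?orbF => /eqP.
Qed.

Lemma lvRt1_cst (f : S1) : lvRt1 f%:P%:P 0 = 0.
Proof. by rewrite /lvRt1 /lv_dE raddf0 !mulr0 subrr. Qed.

Lemma lvRt2_cst (f : S1) Q : lvRt2 f%:P%:P Q = - (f^`())%:P%:P.
Proof. by rewrite /lvRt2 lv_dE_cst. Qed.

Lemma S3_double_eq0 (p : S3) : 2 * p = 0 -> p = 0.
Proof.
have n2 : (2 : S3) != 0 by rewrite -!polyC_natr !polyC_eq0 pnatr_eq0.
by move/eqP; rewrite mulf_eq0 (negPf n2) => /eqP.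
Qed.

(** The next order forces f' = 0. The rotation of the present order then vanishes, so the next order
    is itself an integral of the linear field and the argument can be repeated. *)
Lemma lv_hierarchy_step (P Q P' Q' : S3) :
  lvD1 P Q = 0 -> lvD2 P Q = 0 ->
  2 * lvD1 P' Q' + lvx ^+ 2 * lvRt1 P Q = 0 ->
  2 * lvD2 P' Q' + lvx ^+ 2 * lvRt2 P Q = 0 ->
  (Q = 0 /\ exists c : R, P = c%:P%:P%:P) /\ (lvD1 P' Q' = 0 /\ lvD2 P' Q' = 0).
Proof.
move=> e1 e2; have [_ Qk [f Pk]] := @lv_integral_rigid P Q 0 e1 e2.
rewrite Pk Qk lvRt1_cst lvRt2_cst mulr0 addr0 mulrN => /S3_double_eq0 n1.
move/eqP; rewrite subr_eq0 mulrC [X in _ == X]mulrC => /eqP n2.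
have df : f^`() = 0.
  by apply: (@lv_field_obstruction P' Q' _ n1); rewrite mulrC.
rewrite df polyC0 mul0r mulrC in n2.
split; last by split; [exact: n1|exact: S3_double_eq0 n2].
split=> //; exists f`_0; congr (_%:P%:P); apply: deriv_eq0_polyC df.
by move=> n; rewrite pnatr_eq0.
Qed.

Lemma lv_hierarchy_rigid (P Q : nat -> S3) :
  lvD1 (P 0%N) (Q 0%N) = 0 -> lvD2 (P 0%N) (Q 0%N) = 0 ->
  (forall k, 2 * lvD1 (P k.+1) (Q k.+1) + lvx ^+ 2 * lvRt1 (P k) (Q k) = 0) ->
  (forall k, 2 * lvD2 (P k.+1) (Q k.+1) + lvx ^+ 2 * lvRt2 (P k) (Q k) = 0) ->
  forall k, Q k = 0 /\ exists c : R, P k = c%:P%:P%:P.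
Proof.
move=> d1 d2 s1 s2.
have H k : lvD1 (P k) (Q k) = 0 /\ lvD2 (P k) (Q k) = 0.
  by elim: k => [//|k [e1 e2]]; have [] := lv_hierarchy_step e1 e2 (s1 k) (s2 k).
by move=> k; have [e1 e2] := H k; have [] := lv_hierarchy_step e1 e2 (s1 k) (s2 k).
Qed.

Local Notation S4 := {poly S3}.

Record level_point := LevelPoint
  { pt_s : R; pt_b : R; pt_E : R; pt_V : R; pt_e : R }.

Definition pt_U z := pt_E z - 2^-1 * pt_b z ^+ 2.
Definition on_level z := pt_U z ^+ 2 + pt_V z ^+ 2 = h.

Definition lv_eval (z : level_point) : {rmorphism S4 -> R} :=
  horner_eval (pt_E z) \o horner_eval (pt_b z)%:P \o
  horner_eval (pt_s z)%:P%:P \o horner_eval (pt_e z)%:P%:P%:P.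

Lemma lv_evalE z p : lv_eval z p =
  p.[(pt_e z)%:P%:P%:P].[(pt_s z)%:P%:P].[(pt_b z)%:P].[pt_E z].
Proof. by []. Qed.

Definition lv4_ds : S4 -> S4 := map_poly (@deriv S2).
Definition lv4_db : S4 -> S4 := map_poly lv_db.
Definition lv4_dE : S4 -> S4 := map_poly lv_dE.
Definition lv4_w : S4 := 'X * (lvx ^+ 2)%:P.

Lemma lv_dE_add : {morph lv_dE : p q / p + q}.
Proof. exact/map_derivationD/map_derivationD/derivD. Qed.

Lemma lv_dEM p q : lv_dE (p * q) = lv_dE p * q + p * lv_dE q.
Proof.
apply: map_derivationM; first exact/map_derivationD/derivD.
by apply: map_derivationM; [exact: derivD|exact: derivM].
Qed.

Lemma lv4_dsD : {morph lv4_ds : p q / p + q}.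
Proof. exact/map_derivationD/derivD. Qed.
Lemma lv4_dsM p q : lv4_ds (p * q) = lv4_ds p * q + p * lv4_ds q.
Proof. exact: (map_derivationM (@derivD S2) (@derivM S2)). Qed.
Lemma lv4_dbD : {morph lv4_db : p q / p + q}.
Proof. exact/map_derivationD/lv_dbD. Qed.
Lemma lv4_dbM p q : lv4_db (p * q) = lv4_db p * q + p * lv4_db q.
Proof. exact: (map_derivationM lv_dbD lv_dbM). Qed.
Lemma lv4_dED : {morph lv4_dE : p q / p + q}.
Proof. exact/map_derivationD/lv_dE_add. Qed.
Lemma lv4_dEM p q : lv4_dE (p * q) = lv4_dE p * q + p * lv4_dE q.
Proof. exact: (map_derivationM lv_dE_add lv_dEM). Qed.

Lemma map_poly_fix0 (T : nzRingType) (f : T -> T) (c : T) :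
  f 0 = 0 -> map_poly f c%:P = (f c)%:P.
Proof.
by move=> f0; apply/polyP => i; rewrite coef_map_id0 // !coefC; case: eqP.
Qed.

Lemma lv4_dsC c : lv4_ds c%:P = (c^`())%:P.
Proof. exact/map_poly_fix0/(derivation0 (@derivD S2)). Qed.
Lemma lv4_dbC c : lv4_db c%:P = (lv_db c)%:P.
Proof. exact/map_poly_fix0/(derivation0 lv_dbD). Qed.
Lemma lv4_dEC c : lv4_dE c%:P = (lv_dE c)%:P.
Proof. exact/map_poly_fix0/(derivation0 lv_dE_add). Qed.

Lemma map_derivationX (T : comNzRingType) (d : T -> T) : d 0 = 0 ->
  (forall x y, d (x * y) = d x * y + x * d y) -> map_poly d 'X = 0.
Proof.
move=> d0 dM; apply/polyP => i; rewrite coef_map_id0 // coefX coef0.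
by case: eqP; rewrite ?(derivation1 dM).
Qed.

Lemma lv4_dX : (lv4_ds 'X = 0) * (lv4_db 'X = 0) * (lv4_dE 'X = 0).
Proof.
split; [split|]; apply: map_derivationX.
- exact: (derivation0 (@derivD S2)).
- exact: derivM.
- exact: (derivation0 lv_dbD).
- exact: lv_dbM.
- exact: (derivation0 lv_dE_add).
- exact: lv_dEM.
Qed.

Lemma lvU_db : lvU^`() = - 'X.
Proof.
have e : 2^-1 + 2^-1 = 1 :> R by field.
rewrite /lvU derivB derivC derivM derivC expr2 derivM derivX !(mul0r, sub0r, mul1r, mulr1, add0r).
by move: 2^-1 e => x e; rewrite mulrDr -mulrDl -!polyCD e mul1r.
Qed.

Lemma map_derivM (p q : S2) : map_poly (@deriv R) (p * q)
  = map_poly (@deriv R) p * q + p * map_poly (@deriv R) q.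
Proof. exact: map_derivationM (@derivD R) (@derivM R) p q. Qed.
Lemma map_derivX : map_poly (@deriv R) 'X = 0.
Proof. exact: map_derivationX (derivation0 (@derivD R)) (@derivM R). Qed.

Lemma lvU_dE : map_poly (@deriv R) lvU = 1.
Proof.
rewrite /lvU raddfB /= map_polyC /= derivX map_derivM map_polyC /= derivC.
by rewrite expr2 map_derivM map_derivX !(mul0r, mulr0, addr0, subr0).
Qed.

Lemma lvN_db : lvN^`() = 2 * 'X * lvU.
Proof.
by rewrite /lvN derivB derivC expr2 derivM lvU_db; move: lvU 'X => U X; ring.
Qed.

Lemma lvN_dE : map_poly (@deriv R) lvN = - (2 * lvU).
Proof.
rewrite /lvN raddfB /= map_polyC /= derivC expr2 map_derivM lvU_dE.
by move: lvU => U; ring.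
Qed.

Lemma lv4_dsN : lv4_ds lvN%:P%:P = 0.
Proof. by rewrite lv4_dsC derivC. Qed.
Lemma lv4_dbN : lv4_db lvN%:P%:P = 2 * 'X%:P%:P * lvU%:P%:P.
Proof. by rewrite lv4_dbC lv_dbC lvN_db !polyCM !polyC_natr. Qed.
Lemma lv4_dEN : lv4_dE lvN%:P%:P = - (2 * lvU%:P%:P).
Proof.
by rewrite lv4_dEC /lv_dE map_polyC /= lvN_dE !polyCN !polyCM !polyC_natr.
Qed.

Lemma lv_eval_V2 z : on_level z -> pt_V z ^+ 2 = lv_eval z lvN%:P%:P.
Proof.
move=> vz; rewrite lv_evalE !hornerC /lvN /lvU !expr2.
rewrite !(hornerD, hornerN, hornerM, hornerC, hornerX).
by rewrite -vz /pt_U; ring.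
Qed.

Definition level_pair := @flow_pair S4 R lv4_ds lv4_db lv4_dE
  lvU%:P%:P lvN%:P%:P 'X%:P%:P lv4_w level_point on_level lv_eval pt_V.

Lemma lv4_ds_cst (c : R) : lv4_ds c%:P%:P%:P%:P = 0.
Proof. by rewrite lv4_dsC derivC polyC0. Qed.
Lemma lv4_db_cst (c : R) : lv4_db c%:P%:P%:P%:P = 0.
Proof. by rewrite lv4_dbC lv_dbC derivC !polyC0. Qed.
Lemma lv4_dE_cst (c : R) : lv4_dE c%:P%:P%:P%:P = 0.
Proof. by rewrite lv4_dEC lv_dE_cst derivC !polyC0. Qed.

Lemma level_pair_stationary (P : S4) (f : level_point -> R) :
  lv4_ds P = 0 -> lv4_db P = 0 -> lv4_dE P = 0 ->
  (forall z, f z = lv_eval z P) -> level_pair f (fun=> 0).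
Proof. exact: (flow_pair_stationary lv4_dsD lv4_dbD lv4_dED). Qed.

Lemma level_pair_cst (c : R) : level_pair (fun=> c) (fun=> 0).
Proof.
apply: (level_pair_stationary (lv4_ds_cst c) (lv4_db_cst c) (lv4_dE_cst c)) => z.
by rewrite lv_evalE !hornerC.
Qed.

Lemma level_pairP : derivation_rep on_level level_pair.
Proof.
exact: (flow_pair_derivation_rep lv4_dsD lv4_dsM lv4_dbD lv4_dbM lv4_dED lv4_dEM
  lv4_dsN lv4_dbN lv4_dEN lv_eval_V2 level_pair_cst).
Qed.

Lemma lv_eval_w z : lv_eval z lv4_w =
  pt_e z * (be * pt_b z + ga + si * pt_s z) ^+ 2.
Proof.
rewrite lv_evalE /lv4_w /lvx !(hornerM, hornerC, hornerX, expr2, hornerD).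
by [].
Qed.

Lemma lv_eval_U z : lv_eval z lvU%:P%:P = pt_U z.
Proof.
by rewrite lv_evalE !hornerC /lvU !expr2 !(hornerD, hornerN, hornerM, hornerC, hornerX).
Qed.

Lemma lv_eval_b z : lv_eval z 'X%:P%:P = pt_b z.
Proof. by rewrite lv_evalE !hornerC hornerX hornerC. Qed.

Definition pt_x z := be * pt_b z + ga + si * pt_s z.
(** The whole magnetic field: its linear part b plus the quadratic perturbation. *)
Definition pt_B z := pt_b z + 2^-1 * (pt_e z * pt_x z ^+ 2).

Lemma level_pair_e : level_pair pt_e (fun=> 0).
Proof.
apply: (level_pair_stationary lv4_dX.1.1 lv4_dX.1.2 lv4_dX.2) => z.
by rewrite lv_evalE hornerX !hornerC.
Qed.

Lemma lv_eval0 z : lv_eval z (0 : S4) = 0. Proof. exact: rmorph0. Qed.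
Lemma lv_eval1 z : lv_eval z (1 : S4) = 1. Proof. exact: rmorph1. Qed.
Lemma lv_evalNb z : lv_eval z (- 'X%:P%:P : S4) = - pt_b z.
Proof. by rewrite -lv_eval_b; exact: rmorphN. Qed.

Lemma level_pair_even P a c e f g a' c' e' :
  lv4_ds P = a -> lv4_db P = c -> lv4_dE P = e ->
  (forall z, lv_eval z P = f z) -> (forall z, lv_eval z a = a' z) ->
  (forall z, lv_eval z c = c' z) -> (forall z, lv_eval z e = e' z) ->
  (forall z, 2 * g z = 2 * (pt_U z * a' z)
     + pt_V z * (2 * c' z - pt_e z * pt_x z ^+ 2 * e' z)) ->
  level_pair f g.
Proof.
move=> sP bP EP ef ea ec ee eg.
have {}eg z : 2 * g z = 2 * (lv_eval z lvU%:P%:P * lv_eval z a)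
     + pt_V z * (2 * lv_eval z c - lv_eval z lv4_w * lv_eval z e).
  by rewrite lv_eval_U ea ec ee lv_eval_w -/(pt_x z).
have {}ef z : f z = lv_eval z P by rewrite ef.
clear ea ec ee; move: sP bP EP ef eg.
exact: (flow_pair_even lv4_dsD lv4_dbD lv4_dED).
Qed.

Lemma lv4_dsX : lv4_ds 'X%:P = 1. Proof. by rewrite lv4_dsC derivX polyC1. Qed.
Lemma lv4_dbX : lv4_db 'X%:P = 0. Proof. by rewrite lv4_dbC lv_dbX polyC0. Qed.
Lemma lv4_dEX : lv4_dE 'X%:P = 0.
Proof.
rewrite lv4_dEC (_ : lv_dE 'X = 0) ?polyC0 //.
apply: map_derivationX; first exact: (derivation0 (map_derivationD (@derivD R))).
exact: (map_derivationM (@derivD R) (@derivM R)).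
Qed.
Lemma lv_eval_s z : lv_eval z 'X%:P = pt_s z.
Proof. by rewrite lv_evalE hornerC hornerX !hornerC. Qed.

Lemma lv4_dsXb : lv4_ds 'X%:P%:P = 0.
Proof. by rewrite lv4_dsC derivC polyC0. Qed.
Lemma lv4_dbXb : lv4_db 'X%:P%:P = 1.
Proof. by rewrite lv4_dbC lv_dbC derivX !polyC1. Qed.
Lemma lv4_dEXb : lv4_dE 'X%:P%:P = 0.
Proof. by rewrite lv4_dEC /lv_dE map_polyC /= map_derivX !polyC0. Qed.

Lemma lv4_dsU : lv4_ds lvU%:P%:P = 0.
Proof. by rewrite lv4_dsC derivC polyC0. Qed.
Lemma lv4_dbU : lv4_db lvU%:P%:P = - 'X%:P%:P.
Proof. by rewrite lv4_dbC lv_dbC lvU_db !polyCN. Qed.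
Lemma lv4_dEU : lv4_dE lvU%:P%:P = 1.
Proof. by rewrite lv4_dEC /lv_dE map_polyC /= lvU_dE !polyC1. Qed.

Lemma level_pair_b : level_pair pt_b pt_V.
Proof.
apply: (level_pair_even lv4_dsXb lv4_dbXb lv4_dEXb lv_eval_b lv_eval0 lv_eval1 lv_eval0).
by move=> z; ring.
Qed.

Lemma level_pair_s : level_pair pt_s pt_U.
Proof.
apply: (level_pair_even lv4_dsX lv4_dbX lv4_dEX lv_eval_s lv_eval1 lv_eval0 lv_eval0).
by move=> z; ring.
Qed.

Lemma level_pair_U : level_pair pt_U (fun z => - (pt_B z * pt_V z)).
Proof.
apply: (level_pair_even lv4_dsU lv4_dbU lv4_dEU lv_eval_U lv_eval0 lv_evalNb lv_eval1).
by move=> z; rewrite /pt_B; field.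
Qed.

Lemma level_pair_V : level_pair pt_V (fun z => pt_B z * pt_U z).
Proof.
have eg z : 2 * (pt_B z * pt_U z) =
    (2 * lv_eval z 'X%:P%:P + lv_eval z lv4_w) * lv_eval z lvU%:P%:P.
  by rewrite lv_eval_b lv_eval_w lv_eval_U /pt_B /pt_x; move: (pt_U z) => U; field.
exact: (@flow_pair_V S4 R _ _ _ lv4_dsD lv4_dsM lv4_dbD lv4_dbM lv4_dED lv4_dEM
  lvU%:P%:P lvN%:P%:P 'X%:P%:P lv4_w level_point on_level lv_eval pt_V _ eg).
Qed.

End MagneticLevel.

(** * From functions on a level to polynomial identities *)

Lemma poly_many_roots (T : idomainType) (p : {poly T}) (g : nat -> T) :
  injective g -> (forall n, p.[g n] = 0) -> p = 0.
Proof.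
move=> gi pg; apply/eqP/negP => /negP p0.
have : (size (map g (iota 0 (size p))) < size p)%N.
  apply: max_poly_roots => //; last by rewrite map_inj_uniq // iota_uniq.
  by apply/allP => _ /mapP[n _ ->]; rewrite /root pg.
by rewrite size_map size_iota ltnn.
Qed.

Lemma poly_eq0_of_values (R : numDomainType) (T : idomainType) (c : R -> T)
  (p : {poly T}) : injective c -> (forall x, p.[c x] = 0) -> p = 0.
Proof.
move=> ci pc; apply: (@poly_many_roots _ p (fun n => c n%:R)) => // m n /ci /eqP.
by rewrite eqr_nat => /eqP.
Qed.

(** The outermost variable is p6 and the perturbation carries exactly one factor of it, so order k
    of the flow couples the linear field at order k with the rotation at order k - 1. *)
Lemma coef_flow1 (S : comNzRingType) (a c q e : {poly S}) (U N b x : S) k :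
  (2 * (U%:P * a + N%:P * c + b%:P * U%:P * q)
   + 'X * x%:P * (U%:P * q - N%:P * e))`_k
  = 2 * (U * a`_k + N * c`_k + b * U * q`_k)
    + (if k is k'.+1 then x * (U * q`_k' - N * e`_k') else 0).
Proof.
rewrite coefD -polyC_natr coefCM !coefD -mulrA !coefCM -!mulrA coefXM.
by case: k => [|k] //=; rewrite coefCM coefB !coefCM.
Qed.

Lemma coef_flow2 (S : comNzRingType) (p a e : {poly S}) (U x : S) k :
  (2 * (p + U%:P * a) - 'X * x%:P * e)`_k
  = 2 * (p`_k + U * a`_k) - (if k is k'.+1 then x * e`_k' else 0).
Proof.
rewrite coefB -polyC_natr coefCM !coefD !coefCM -!mulrA coefXM.
by case: k => [|k] //=; rewrite coefCM.
Qed.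

Section LevelRigidity.
Variables (R : rcfType) (h be ga si : R).
Hypotheses (h0 : 0 < h) (be0 : be != 0) (si0 : si != 0).
Local Notation S1 := {poly R}.
Local Notation S2 := {poly S1}.
Local Notation S3 := {poly S2}.
Local Notation S4 := {poly S3}.

(** These energies correspond to U = sqrt h / (n + 2), which stays strictly below sqrt h. For each b
    they give infinitely many values of E at which V^2 = h - U^2 is positive. *)
Let E n (b : R) : R := 2^-1 * b ^+ 2 + Num.sqrt h / n.+2%:R.
Let V n : R := Num.sqrt (h - (Num.sqrt h / n.+2%:R) ^+ 2).

Let V_gt0 n : 0 < V n.
Proof.
rewrite sqrtr_gt0 subr_gt0 expr_div_n sqr_sqrtr ?ltW //.
rewrite ltr_pdivrMr ?exprn_gt0 // -[X in X < _]mulr1 ltr_pM2l // -natrX ltr1n.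
by rewrite (@leq_trans (n.+2 ^ 1)) // leq_exp2l.
Qed.

Let on_V n s b e v : v ^+ 2 = V n ^+ 2 -> on_level h (LevelPoint s b (E n b) v e).
Proof.
move=> ev; rewrite /on_level /pt_U /= ev /V sqr_sqrtr /E; first by ring.
by rewrite ltW // -sqrtr_gt0 V_gt0.
Qed.

Lemma lv_eval_eq0 (A : S4) :
  (forall n s b e v, lv_eval (LevelPoint s b (E n b) v e) A = 0) -> A = 0.
Proof.
move=> H.
have inj1 (T : nzRingType) : injective (@polyC T) := @polyC_inj T.
apply: (@poly_eq0_of_values R _ (fun e => e%:P%:P%:P)) => [x y /inj1 /inj1 /inj1 //|e].
apply: (@poly_eq0_of_values R _ (fun e => e%:P%:P)) => [x y /inj1 /inj1 //|s].
apply: (@poly_eq0_of_values R _ (fun e => e%:P)) => [x y /inj1 //|b].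
(* E is the innermost variable, so b is already fixed when the sample energies, which depend on it,
   are used. *)
apply: (@poly_many_roots _ _ (fun n => E n b)) => [m n|n].
  have r0 : Num.sqrt h != 0 by rewrite gt_eqF // sqrtr_gt0.
  by move=> /addrI /(mulfI r0) /invr_inj /eqP; rewrite eqr_nat => /eqP[].
by have := H n s b e 0; rewrite lv_evalE.
Qed.

(** The level is symmetric under V -> - V; since V is nonzero at the sample points, the two signs
    separate A from B. *)
Lemma level_pair_eval_eq0 (A B : S4) :
  (forall z, on_level h z -> pair_eval (@lv_eval R) (@pt_V R) A B z = 0) ->
  A = 0 /\ B = 0.
Proof.
move=> H.
have HAB n s b e v : lv_eval (LevelPoint s b (E n b) v e) A = 0 /\
    lv_eval (LevelPoint s b (E n b) v e) B = 0.
  have e1 := H _ (on_V s b e (erefl (V n ^+ 2))).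
  have e2 := H _ (on_V s b e (sqrrN (V n))).
  move: e1 e2; rewrite /pair_eval !lv_evalE /=.
  move: (_.[E n b]) (_.[E n b]) (V_gt0 n) => y x v0 e1 e2.
  have /eqP : V n * y = 0 by move: e1 e2; rewrite mulNr; lra.
  rewrite mulf_eq0 gt_eqF //= => /eqP y0.
  by move: e1; rewrite y0 mulr0 addr0.
split; apply: lv_eval_eq0 => n s b e v; by have [] := HAB n s b e v.
Qed.

Lemma coef_lv4_d (P : S4) k :
  ((lv4_ds P)`_k = (P`_k)^`()) * ((lv4_db P)`_k = lv_db P`_k) *
  ((lv4_dE P)`_k = lv_dE P`_k).
Proof.
split; [split|]; rewrite coef_map_derivation //.
- exact: derivD.
- exact: lv_dbD.
- exact: lv_dE_add.
Qed.

Lemma pair_flow_rigid (P Q : S4) :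
  pair_flow1 lv4_ds lv4_db lv4_dE (@lvU R)%:P%:P (lvN h)%:P%:P 'X%:P%:P
    (lv4_w be ga si) P Q = 0 ->
  pair_flow2 lv4_ds lv4_db lv4_dE (@lvU R)%:P%:P (lv4_w be ga si) P Q = 0 ->
  forall k, Q`_k = 0 /\ exists c : R, P`_k = c%:P%:P%:P.
Proof.
move=> F1 F2.
have c1 k := coef_flow1 (lv4_ds P) (lv4_db Q) Q (lv4_dE Q)
  (@lvU R)%:P (lvN h)%:P 'X%:P (lvx be ga si ^+ 2) k.
have c2 k := coef_flow2 (lv4_db P) (lv4_ds Q) (lv4_dE P)
  (@lvU R)%:P (lvx be ga si ^+ 2) k.
have {}c1 k := etrans (esym (c1 k)) (congr1 (fun p : S4 => p`_k) F1).
have {}c2 k := etrans (esym (c2 k)) (congr1 (fun p : S4 => p`_k) F2).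
apply: (@lv_hierarchy_rigid R h be ga si _ be0 si0).
- exact: lt0r_neq0.
- apply: S3_double_eq0; have := c1 0%N; rewrite !coef_lv4_d coef0 addr0.
  exact: id.
- apply: S3_double_eq0; have := c2 0%N; rewrite !coef_lv4_d coef0 subr0.
  exact: id.
- move=> k; have := c1 k.+1; rewrite !coef_lv4_d coef0; exact: id.
move=> k; have := c2 k.+1; rewrite !coef_lv4_d coef0 /lvRt2 mulrN; exact: id.
Qed.

Lemma level_integral_constant (f : level_point -> R) :
  level_pair h be ga si f (fun=> 0) ->
  exists c : R -> R, forall z, on_level h z -> f z = c (pt_e z).
Proof.
move=> [P [Q H]].
have [F1 F2] : pair_flow1 lv4_ds lv4_db lv4_dE
    (@lvU R)%:P%:P (lvN h)%:P%:P 'X%:P%:P (lv4_w be ga si) P Q = 0 /\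
  pair_flow2 lv4_ds lv4_db lv4_dE
    (@lvU R)%:P%:P (lv4_w be ga si) P Q = 0.
  apply: level_pair_eval_eq0 => z /H[_ <-]; exact: mulr0.
have rig := pair_flow_rigid F1 F2.
have Q0 : Q = 0 by apply/polyP => k; rewrite (rig k).1 coef0.
exists (fun e => \sum_(k < size P) P`_k`_0`_0`_0 * e ^+ k) => z /H[-> _].
rewrite /pair_eval Q0 (raddf0 (lv_eval z)) mulr0 addr0 lv_evalE.
rewrite (horner_coef P) !horner_sum; apply: eq_bigr => k _.
have [_ [c ->]] := rig k.
by rewrite -!rmorphXn /= !hornerM !hornerC !coefC.
Qed.

End LevelRigidity.

(** * Polynomiality in the base variables *)

Lemma is_derive_mulr (R : realType) (V : normedModType R) (f : V -> R) x v f' (k : R) :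
  is_derive x v f f' -> is_derive x v (fun y => f y * k) (f' * k).
Proof.
move=> df; rewrite (_ : (fun y => _) = k *: f); last first.
  by apply/funext => t; rewrite /= mulrC.
by rewrite mulrC; exact: is_deriveZ.
Qed.

Lemma is_derive_bigsum (R : realType) (V : normedModType R) (I : Type) (r : seq I)
    (P : pred I) (h : I -> V -> R) (dh : I -> R) x v :
  (forall i, is_derive x v (h i) (dh i)) ->
  is_derive x v (fun y => \sum_(i <- r | P i) h i y) (\sum_(i <- r | P i) dh i).
Proof.
move=> dhi; elim: r => [|i r IH].
  rewrite big_nil (_ : (fun y => _) = cst 0); first exact: is_derive_cst.
  by apply/funext => y; rewrite big_nil.
rewrite big_cons; case Pi: (P i).
  rewrite (_ : (fun y => _) = h i + (fun y => \sum_(i <- r | P i) h i y)).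
    exact: is_deriveD.
  by apply/funext => y; rewrite big_cons Pi.
rewrite (_ : (fun y => _) = (fun y => \sum_(i <- r | P i) h i y)) //.
by apply/funext => y; rewrite big_cons Pi.
Qed.

Section PolynomialInFirst.
Context {R : realType}.
Implicit Types (f g : R -> R -> R) (c : R -> {poly R}).

Lemma is_derive_unique (V W : normedModType R) (f : V -> W) x v a b :
  is_derive x v f a -> is_derive x v f b -> a = b.
Proof. by move=> [_ <-] [_ <-]. Qed.

Lemma is_derive_horner (p : {poly R}) (x : R) : is_derive x (1 : R) (horner p) (deriv p).[x].
Proof.
by apply: DeriveDef; [exact: derivable_horner|rewrite -derive1E derivE].
Qed.

Definition lagrange_basis n (i : 'I_n) : {poly R} :=
  tnth (lagrange n (fun k : nat => k%:R : R)) i.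

Lemma lagrange_interpolation n (p : {poly R}) : (size p <= n)%N ->
  p = \sum_(i < n) p.[i%:R]%:P * lagrange_basis i.
Proof.
case: n => [|n] sp; last first.
  apply: lagrange_gen => // i j /eqP; by rewrite eqr_nat => /eqP.
by rewrite big_ord0; apply/eqP; rewrite -size_poly_eq0 -leqn0.
Qed.

(** The coefficients are arbitrary functions of y, but the degree is bounded uniformly in y; the
    bound is what allows interpolation at nodes independent of y. *)
Definition polynomial_in_first g : Prop :=
  exists n c, (forall y, (size (c y) <= n)%N) /\ forall x y, g x y = (c y).[x].

Lemma pif_ext f g : (forall x y, f x y = g x y) ->
  polynomial_in_first f -> polynomial_in_first g.
Proof. by move=> fg [n [c [sc H]]]; exists n, c; split => // x y; rewrite -fg. Qed.

Lemma pif_cst (b : R -> R) : polynomial_in_first (fun x y => b y).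
Proof.
exists 1%N, (fun y => (b y)%:P); split=> [y|x y]; last by rewrite hornerC.
exact: size_polyC_leq1.
Qed.

Lemma pif_first : polynomial_in_first (fun x y => x).
Proof. by exists 2%N, (fun=> 'X); split=> [y|x y]; rewrite ?size_polyX ?hornerX. Qed.

Lemma pifD f g : polynomial_in_first f -> polynomial_in_first g ->
  polynomial_in_first (fun x y => f x y + g x y).
Proof.
move=> [n [c [sc H]]] [m [e [se K]]]; exists (maxn n m), (fun y => c y + e y).
split=> [y|x y]; last by rewrite H K hornerD.
rewrite (leq_trans (size_polyD _ _)) // geq_max !leq_max sc orTb.
by rewrite se orbT.
Qed.

Lemma pifM f g : polynomial_in_first f -> polynomial_in_first g ->
  polynomial_in_first (fun x y => f x y * g x y).
Proof.
move=> [n [c [sc H]]] [m [e [se K]]]; exists (n + m)%N, (fun y => c y * e y).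
split=> [y|x y]; last by rewrite H K hornerM.
by rewrite (leq_trans (size_polyMleq _ _)) // (leq_trans (leq_pred _)) // leq_add.
Qed.

Lemma pifB f g : polynomial_in_first f -> polynomial_in_first g ->
  polynomial_in_first (fun x y => f x y - g x y).
Proof.
move=> pf pg; apply: pif_ext (pifD pf (pifM (pif_cst (fun=> -1)) pg)) => x y.
by rewrite mulN1r.
Qed.

Lemma pif_derive_first g g' : (forall x y, is_derive (x : R) (1 : R) (g ^~ y) (g' x y)) ->
  polynomial_in_first g -> polynomial_in_first g'.
Proof.
move=> dg [n [c [sc H]]]; exists n, (fun y => deriv (c y)); split=> [y|x y].
  by rewrite (leq_trans _ (sc y)) // (leq_trans (size_poly _ _)) // leq_pred.
apply: is_derive_unique (dg x y) _.
by rewrite (_ : g ^~ y = horner (c y)); [exact: is_derive_horner|exact/funext].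
Qed.

(* Interpolating in x writes g as a combination of the functions g i%:R, so
   that the derivative in y does not destroy polynomiality in x. *)
Lemma pif_interpolation g : polynomial_in_first g ->
  exists n (L : 'I_n -> {poly R}), forall x y, g x y = \sum_(i < n) g i%:R y * (L i).[x].
Proof.
move=> [n [c [sc H]]]; exists n, (@lagrange_basis n) => x y.
rewrite H [in LHS](lagrange_interpolation (sc y)) horner_sum.
by apply: eq_bigr => i _; rewrite hornerM hornerC H.
Qed.

Lemma pif_derive_second g g' : (forall x y, is_derive (y : R) (1 : R) (g x) (g' x y)) ->
  polynomial_in_first g -> polynomial_in_first g'.
Proof.
move=> dg /pif_interpolation[n [L H]].
have sum_pif m (F : 'I_m -> R -> R -> R) : (forall i, polynomial_in_first (F i)) ->
    polynomial_in_first (fun x y => \sum_(i < m) F i x y).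
  elim: m F => [|m IH] F pF.
    by apply: pif_ext (pif_cst (fun=> 0)) => x y; rewrite big_ord0.
  apply: pif_ext (pifD (pF ord0) (IH _ (fun i => pF (lift ord0 i)))) => x y.
  by rewrite big_ord_recl.
apply: (@pif_ext (fun x y => \sum_(i < n) g' i%:R y * (L i).[x])).
  move=> x y; apply: is_derive_unique _ (dg x y).
  rewrite (_ : g x = fun y => \sum_(i < n) g i%:R y * (L i).[x]); last exact/funext.
  by apply: is_derive_bigsum => i; exact: is_derive_mulr.
apply: sum_pif => i; apply: pifM; first exact: pif_cst.
by exists (size (L i)), (fun=> L i); split.
Qed.

Definition antideriv (p : {poly R}) : {poly R} :=
  \poly_(i < (size p).+1) (p`_i.-1 / i%:R).

Lemma antiderivK p : deriv (antideriv p) = p.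
Proof.
apply/polyP => i; rewrite coef_deriv coef_poly ltnS /=.
case: ltnP => [_|/leq_sizeP si]; last by rewrite mul0rn si.
by rewrite -[_ *+ i.+1]mulr_natr divfK // pnatr_eq0.
Qed.

(** The constant of integration [g 0 y] is an uncontrolled function of y, which
    [polynomial_in_first] tolerates. *)
Lemma pif_antiderivative g g' : (forall x y, is_derive (x : R) (1 : R) (g ^~ y) (g' x y)) ->
  polynomial_in_first g' -> polynomial_in_first g.
Proof.
move=> dg [n [c [sc H]]].
exists (maxn n.+1 1), (fun y => antideriv (c y) + (g 0 y - (antideriv (c y)).[0])%:P).
split=> [y|x y].
  rewrite (leq_trans (size_polyD _ _)) // geq_max !leq_max size_polyC_leq1 orbT andbT.
  by rewrite (leq_trans (size_poly _ _)) // ltnS.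
pose k x := g x y - (antideriv (c y)).[x].
suff : k x = k 0 by rewrite /k hornerD hornerC => /eqP; rewrite subr_eq addrC => /eqP.
apply: is_derive_0_is_cst => t.
rewrite -(subrr (g' t y)); apply: is_deriveB.
by rewrite H -{2}(antiderivK (c y)); exact: is_derive_horner.
Qed.

End PolynomialInFirst.

(** * The triangular system for the coefficients of the momenta *)

Section Triangular.
Context {R : realType}.
Variables (n : nat) (A Ax Ay : nat -> nat -> R -> R -> R).
Variables (al be alx aly bex bey : R -> R -> R).
Hypothesis dAx : forall i j x y, is_derive (x : R) (1 : R) (A i j ^~ y) (Ax i j x y).
Hypothesis dAy : forall i j x y, is_derive (y : R) (1 : R) (A i j x) (Ay i j x y).
Hypothesis A0 : forall i j x y, (n <= i + j)%N -> A i j x y = 0.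

Let X i j x y := Ax i j x y + alx x y * (A i.+1 j x y *+ i.+1)
  + aly x y * (A i j.+1 x y *+ j.+1).
Let Y i j x y := Ay i j x y + bex x y * (A i.+1 j x y *+ i.+1)
  + bey x y * (A i j.+1 x y *+ j.+1).

Hypotheses (pal : polynomial_in_first al) (palx : polynomial_in_first alx)
  (paly : polynomial_in_first aly) (pbe : polynomial_in_first be)
  (pbex : polynomial_in_first bex) (pbey : polynomial_in_first bey).
Hypothesis eqn : forall i j x y,
  X i j x y + (if j is j'.+1 then Y i.+1 j' x y else 0)
  = al x y * X i.+1 j x y + be x y * Y i.+1 j x y.

Let pifn (f : R -> R -> R) k : polynomial_in_first f -> polynomial_in_first (fun x y => f x y *+ k).
Proof.
move=> pf; apply: pif_ext (pifM (pif_cst (fun=> k%:R)) pf) => x y.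
by rewrite mulr_natl.
Qed.

(** [eqn] is the coefficient of p^(i+1) q^j in (p - al) X + (q - be) Y = 0. It expresses the
    x-derivative of A_(i,j) through coefficients of higher total degree and the y-derivative of
    A_(i+1,j-1), which has the same total degree but a smaller exponent of q. For j = 0 the latter
    is absent. *)
Lemma triangular_polynomial_in_first i j : polynomial_in_first (A i j).
Proof.
(* [m] bounds the distance of the total degree from n, where all coefficients vanish; within one
   total degree the induction runs upwards on the exponent [k] of q. *)
suff H m k : forall i, (n <= i + k + m)%N -> polynomial_in_first (A i k).
  by apply: (H n); rewrite leq_addl.
elim: m k => [|m IHm] k.
  move=> {}i; rewrite addn0 => ni.
  by apply: (@pif_ext _ (fun _ _ => 0)) (pif_cst (fun=> 0)) => x y; rewrite A0.
have IH' k' i' : (n <= i' + k' + m)%N -> polynomial_in_first (A i' k') by exact: IHm.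
have pX i' k' : (n <= i' + k' + m)%N -> polynomial_in_first (X i' k').
  move=> le; apply: pifD; [apply: pifD|].
  - exact/(pif_derive_first (dAx i' k'))/IH'.
  - by apply: pifM => //; apply/pifn/IH'; lia.
  - by apply: pifM => //; apply/pifn/IH'; lia.
have pY i' k' : polynomial_in_first (A i' k') -> (n <= i' + k' + m.+1)%N ->
    polynomial_in_first (Y i' k').
  move=> pA le; apply: pifD; [apply: pifD|].
  - exact: pif_derive_second (dAy i' k') pA.
  - by apply: pifM => //; apply/pifn/IH'; lia.
  - by apply: pifM => //; apply/pifn/IH'; lia.
elim: k => [|k IHk] {}i le.
  apply: (pif_antiderivative (dAx i 0)).
  apply: (@pif_ext _ (fun x y => al x y * X i.+1 0 x y + be x y * Y i.+1 0 x y
    - alx x y * (A i.+1 0 x y *+ i.+1) - aly x y * (A i 1 x y *+ 1))).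
    by move=> x y; rewrite -eqn /X; ring.
  have p1 : polynomial_in_first (A i.+1 0) by apply: IH'; lia.
  apply: pifB; [apply: pifB; [apply: pifD|]|]; apply: pifM => //.
  - by apply: pX; lia.
  - by apply: pY => //; lia.
  - exact: pifn.
  - by apply/pifn/IH'; lia.
apply: (pif_antiderivative (dAx i k.+1)).
apply: (@pif_ext _ (fun x y => al x y * X i.+1 k.+1 x y + be x y * Y i.+1 k.+1 x y
    - Y i.+1 k x y
    - alx x y * (A i.+1 k.+1 x y *+ i.+1) - aly x y * (A i k.+2 x y *+ k.+2))).
  by move=> x y; rewrite -eqn /X; ring.
have p1 : polynomial_in_first (A i.+1 k.+1) by apply: IH'; lia.
apply: pifB; [apply: pifB; [apply: pifB; [apply: pifD|]|]|].
- by apply: pifM => //; apply: pX; lia.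
- by apply: pifM => //; apply: pY => //; lia.
- by apply: pY; [apply: IHk; lia|lia].
- by apply: pifM => //; exact: pifn.
- by apply: pifM => //; apply/pifn/IH'; lia.
Qed.

End Triangular.

Section Bipolynomial.
Context {R : realType}.

Definition bipolynomial (g : R -> R -> R) : Prop :=
  exists P : {poly {poly R}}, forall x y, g x y = P.[x%:P].[y].

(** Interpolation in x leaves only finitely many functions g(i, y) of y, each of them a
    polynomial. *)
Lemma bipolynomial_of_partial (g : R -> R -> R) :
  polynomial_in_first g -> polynomial_in_first (fun x y => g y x) -> bipolynomial g.
Proof.
move=> /pif_interpolation[n [L H]] [m [c [_ K]]].
exists (\sum_(i < n) (c i%:R)%:P * map_poly polyC (L i)) => x y.
rewrite H !horner_sum; apply: eq_bigr => i _.
by rewrite hornerM hornerC horner_map hornerM hornerC K.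
Qed.

Lemma bipolynomial_lincomb n (g : 'I_n -> R -> R -> R) (l : 'I_n -> R) :
  (forall i, bipolynomial (g i)) ->
  bipolynomial (fun x y => \sum_(i < n) g i x y * l i).
Proof.
move=> /(_ _)/cid-/all_sig[P H]; exists (\sum_(i < n) (l i)%:P%:P * P i) => x y.
rewrite !horner_sum; apply: eq_bigr => i _.
by rewrite !hornerM !hornerC mulrC H.
Qed.

Lemma rep_horner (pt : Type) (valid : pt -> Prop) rep (p : {poly R}) f f' :
  derivation_rep valid rep -> rep f f' ->
  rep (fun z => p.[f z]) (fun z => (deriv p).[f z] * f' z).
Proof.
move=> repP H; elim/poly_ind: p => [|p c IH].
  by apply: (rep_eq repP) (rep_cst repP 0) => z _; rewrite ?deriv0 !horner0 ?mul0r.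
apply: (rep_eq repP) (repD repP (repM repP IH H) (rep_cst repP c)) => z _.
  by rewrite hornerMXaddC.
rewrite derivD derivM derivX derivC !(hornerD, hornerM, hornerX, hornerC).
by ring.
Qed.

(** The chain rule for [rep]. Uniqueness of derivatives identifies the analytic partial derivatives
    of g with the formal ones of its polynomial, after which induction on the polynomial needs only
    the rules of [derivation_rep]. *)
Lemma rep_bipolynomial (pt : Type) (valid : pt -> Prop) rep (g gx gy : R -> R -> R) f f' k k' :
  derivation_rep valid rep -> bipolynomial g ->
  (forall x y, is_derive (x : R) (1 : R) (g ^~ y) (gx x y)) ->
  (forall x y, is_derive (y : R) (1 : R) (g x) (gy x y)) ->
  rep f f' -> rep k k' ->
  rep (fun z => g (f z) (k z))
      (fun z => gx (f z) (k z) * f' z + gy (f z) (k z) * k' z).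
Proof.
move=> repP [P H] dx dy rf rk.
have ex x y : gx x y = (deriv P).[x%:P].[y].
  apply: is_derive_unique (dx x y) _.
  pose Q := map_poly (horner_eval y) P.
  have <- : (deriv Q).[x] = (deriv P).[x%:P].[y].
    rewrite /Q deriv_map -[RHS]/(horner_eval y _) -horner_map /=.
    by rewrite /horner_eval hornerC.
  rewrite (_ : g ^~ y = horner Q); first exact: is_derive_horner.
  apply/funext => t; rewrite H /Q -[LHS]/(horner_eval y _) -horner_map /=.
  by rewrite /horner_eval hornerC.
have ey x y : gy x y = (deriv P.[x%:P]).[y].
  apply: is_derive_unique (dy x y) _.
  by rewrite (_ : g x = horner P.[x%:P]); [exact: is_derive_horner|apply/funext=> t].
suff : rep (fun z => P.[(f z)%:P].[k z])
    (fun z => (deriv P).[(f z)%:P].[k z] * f' z + (deriv P.[(f z)%:P]).[k z] * k' z).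
  by apply: (rep_eq repP) => z _; rewrite ?H ?ex ?ey.
elim/poly_ind: P {H ex ey} => [|P c IH].
  by apply: (rep_eq repP) (rep_cst repP 0) => z _;
    rewrite ?deriv0 !horner0 ?deriv0 ?horner0 ?mul0r ?addr0.
apply: (rep_eq repP) (repD repP (repM repP IH rf) (rep_horner c repP rk)) => z _.
  by rewrite hornerMXaddC hornerD hornerM hornerC.
rewrite hornerMXaddC [deriv (_ + c)]derivD derivM derivC.
rewrite [deriv (P * _ + _)]derivD derivM derivX derivC.
by rewrite !(hornerD, hornerM, hornerX, hornerC); ring.
Qed.

End Bipolynomial.

(** * Polynomial coefficients at a fixed value of p6 *)

Section KillingCoefficients.
Context {R : realType}.
Variables (I : finType) (n : nat) (ei ej : I -> nat).
Variables (b bx bY : I -> R -> R -> R).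
Variables (al be alx aly bex bey : R -> R -> R).
Hypothesis e_lt : forall t, (ei t + ej t < n)%N.
Hypothesis dbx : forall t x y, is_derive (x : R) (1 : R) (b t ^~ y) (bx t x y).
Hypothesis dby : forall t x y, is_derive (y : R) (1 : R) (b t x) (bY t x y).

(** The derivative of the sum of b_t p^i q^j along the Hamiltonian flow x' = u, y' = v, p' = u alx +
    v bex, q' = u aly + v bey, where u = p - al and v = q - be. *)
Definition transport_sum x y (p q : R) : R :=
  let u := p - al x y in let v := q - be x y in
  \sum_t ((u * bx t x y + v * bY t x y) * (p ^+ ei t * q ^+ ej t)
    + b t x y * ((u * alx x y + v * bex x y) * (p ^+ (ei t).-1 * q ^+ ej t *+ ei t)
               + (u * aly x y + v * bey x y) * (p ^+ ei t * q ^+ (ej t).-1 *+ ej t))).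

Hypothesis transport : forall x y p q, transport_sum x y p q = 0.

Let coefs (c : I -> R -> R -> R) (i j : nat) x y : R :=
  \sum_(t | (ei t == i) && (ej t == j)) c t x y.
Let mom (c : I -> R -> R -> R) x y : {poly {poly R}} :=
  \sum_t (c t x y *: 'X^(ej t))%:P * 'X^(ei t).

Let coef_mom c x y i j : (mom c x y)`_i`_j = coefs c i j x y.
Proof.
rewrite /mom /coefs !coef_sum [RHS]big_mkcond; apply: eq_bigr => t _.
rewrite coefCM coefXn [ei t == i]eq_sym [ej t == j]eq_sym.
case: eqP => _ /=; last by rewrite mulr0 coef0.
by rewrite mulr1 coefZ coefXn; case: eqP; rewrite ?mulr1 ?mulr0.
Qed.

Let X i j x y := coefs bx i j x y + alx x y * (coefs b i.+1 j x y *+ i.+1)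
  + aly x y * (coefs b i j.+1 x y *+ j.+1).
Let Y i j x y := coefs bY i j x y + bex x y * (coefs b i.+1 j x y *+ i.+1)
  + bey x y * (coefs b i j.+1 x y *+ j.+1).

Let momX x y := mom bx x y + (alx x y)%:P%:P * deriv (mom b x y)
  + (aly x y)%:P%:P * map_poly (@deriv R) (mom b x y).
Let momY x y := mom bY x y + (bex x y)%:P%:P * deriv (mom b x y)
  + (bey x y)%:P%:P * map_poly (@deriv R) (mom b x y).

Let coef_momX x y i j : (momX x y)`_i`_j = X i j x y.
Proof.
rewrite /momX !coefD !coefCM !coef_deriv coef_map coef_deriv /= coefMn.
by rewrite !coef_mom.
Qed.
Let coef_momY x y i j : (momY x y)`_i`_j = Y i j x y.
Proof.
rewrite /momY !coefD !coefCM !coef_deriv coef_map coef_deriv /= coefMn.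
by rewrite !coef_mom.
Qed.

Let transport_poly x y :
  ('X - (al x y)%:P%:P) * momX x y + ('X%:P - (be x y)%:P%:P) * momY x y = 0.
Proof.
apply: (@poly_eq0_of_values R _ (fun p => p%:P)) => [p q /polyC_inj //|p].
apply: (@poly_eq0_of_values R _ (fun p => p)) => // q.
rewrite -[RHS](transport x y p q) /transport_sum.
have mE c : (mom c x y).[p%:P].[q] = \sum_t c t x y * (p ^+ ei t * q ^+ ej t).
  rewrite /mom !horner_sum; apply: eq_bigr => t _.
  rewrite hornerM hornerC hornerXn -rmorphXn hornerM hornerZ hornerXn hornerC.
  by rewrite [X in _ = _ * X]mulrC mulrA.
have mdE c : (deriv (mom c x y)).[p%:P].[q]
    = \sum_t c t x y * (p ^+ (ei t).-1 * q ^+ ej t *+ ei t).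
  rewrite /mom raddf_sum /= !horner_sum; apply: eq_bigr => t _.
  rewrite derivM derivC mul0r add0r derivXn hornerM hornerC hornerMn hornerXn.
  rewrite -rmorphXn hornerM hornerZ hornerXn hornerMn hornerC.
  by rewrite !mulrnAr -mulrA [q ^+ _ * _]mulrC.
have mqE c : (map_poly (@deriv R) (mom c x y)).[p%:P].[q]
    = \sum_t c t x y * (p ^+ ei t * q ^+ (ej t).-1 *+ ej t).
  rewrite /mom raddf_sum /= !horner_sum; apply: eq_bigr => t _.
  have -> : map_poly (@deriv R) ((c t x y *: 'X^(ej t))%:P * 'X^(ei t))
     = (c t x y *: ('X^((ej t).-1) *+ ej t))%:P * 'X^(ei t).
    apply/polyP => k; rewrite coef_map /= !coefMXn; case: ifP => _.
      by rewrite raddf0.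
    by rewrite !coefC; case: eqP => _; rewrite ?raddf0 // derivZ derivXn.
  rewrite hornerM hornerC hornerXn -rmorphXn hornerM hornerZ hornerMn hornerXn hornerC.
  by rewrite -[in RHS]mulrnAr -mulrA [_ *+ _ * _]mulrC.
rewrite !(hornerD, hornerM, hornerN, hornerX, hornerC).
rewrite !mE !mdE !mqE !mulr_sumr -!big_split /= !mulr_sumr -big_split /=.
by apply: eq_bigr => t _; ring.
Qed.

Let coef_transport x y i j :
  ((if i is i'.+1 then X i' j x y else 0) - al x y * X i j x y)
  + ((if j is j'.+1 then Y i j' x y else 0) - be x y * Y i j x y) = 0.
Proof.
have gen (p q : {poly {poly R}}) a c :
  (('X - a%:P%:P) * p + ('X%:P - c%:P%:P) * q)`_i`_j
  = ((if i is i'.+1 then p`_i'`_j else 0) - a * p`_i`_j)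
    + ((if j is j'.+1 then q`_i`_j' else 0) - c * q`_i`_j).
  rewrite !mulrBl !(coefD, coefN, coefXM, coefCM) /=.
  by case: i => [|i]; case: j => [|j] /=; rewrite ?coef0.
have := congr1 (fun p : {poly {poly R}} => p`_i`_j) (transport_poly x y).
rewrite /= gen !coef0 coef_momX coef_momY => e; rewrite -[RHS]e {e gen}.
by case: i => [|i]; case: j => [|j]; rewrite ?coef_momX ?coef_momY.
Qed.

Let coefs0 (c : I -> R -> R -> R) i j x y : (n <= i + j)%N -> coefs c i j x y = 0.
Proof.
move=> le; rewrite /coefs big_pred0 // => t.
by apply/negP => /andP[/eqP ei' /eqP ej']; have := e_lt t; lia.
Qed.

Hypotheses (pal : polynomial_in_first al) (palx : polynomial_in_first alx)
  (paly : polynomial_in_first aly) (pbe : polynomial_in_first be)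
  (pbex : polynomial_in_first bex) (pbey : polynomial_in_first bey).
Let sw (f : R -> R -> R) x y := f y x.
Hypotheses (qal : polynomial_in_first (sw al)) (qalx : polynomial_in_first (sw alx))
  (qaly : polynomial_in_first (sw aly)) (qbe : polynomial_in_first (sw be))
  (qbex : polynomial_in_first (sw bex)) (qbey : polynomial_in_first (sw bey)).

Lemma killing_coefficient_bipolynomial i j :
  bipolynomial (fun x y => \sum_(t | (ei t == i) && (ej t == j)) b t x y).
Proof.
apply: bipolynomial_of_partial.
  apply: (@triangular_polynomial_in_first R n (coefs b) (coefs bx) (coefs bY)
    al be alx aly bex bey) => //.
  - by move=> i' j' x y; apply: is_derive_bigsum => t.
  - by move=> i' j' x y; apply: is_derive_bigsum => t.
  - by move=> i' j' x y; exact: coefs0.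
  move=> i' j' x y; have := coef_transport x y i'.+1 j'; rewrite /X /Y.
  by case: j' => [|j']; lra.
(* The system is symmetric under exchanging x with y, the two momenta and the two potentials; this
   gives polynomiality in y. *)
apply: (@triangular_polynomial_in_first R n (fun i j => sw (coefs b j i))
    (fun i j => sw (coefs bY j i)) (fun i j => sw (coefs bx j i))
    (sw be) (sw al) (sw bey) (sw bex) (sw aly) (sw alx)) => //.
- by move=> i' j' x y; apply: is_derive_bigsum => t.
- by move=> i' j' x y; apply: is_derive_bigsum => t.
- by move=> i' j' x y; rewrite addnC; exact: coefs0.
move=> i' j' x y; rewrite /sw.
have := coef_transport y x j' i'.+1; rewrite /X /Y.
by case: j' => [|j']; lra.
Qed.

End KillingCoefficients.

(** * Integrals of the planar magnetic flow *)

Section PlanarMagneticFlow.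
Context {R : realType}.
Variables (p3 p4 p5 : R).

(* The gauge potentials: p1 = u + gauge1, p2 = v + gauge2, for the magnetic
   field p3 + p4 x + p5 y + e x^2 / 2; e stands for p6. *)
Definition gauge1 (e x y : R) : R :=
  2^-1 * (y * p3) + x * y * p4 + 2^-1 * (x ^+ 2 * y * e).
Definition gauge1x (e x y : R) : R := y * p4 + x * y * e.
Definition gauge1y (e x y : R) : R := 2^-1 * p3 + x * p4 + 2^-1 * (x ^+ 2 * e).
Definition gauge2 (e x y : R) : R := - (2^-1 * (x * p3) + x * y * p5).
Definition gauge2x (e x y : R) : R := - (2^-1 * p3 + y * p5).
Definition gauge2y (e x y : R) : R := - (x * p5).

Variables (I : finType) (n : nat) (ei ej ek : I -> nat).
Variables (b bx bY : I -> R -> R -> R).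
Hypothesis e_lt : forall t, (ei t + ej t < n)%N.
Hypothesis ek_lt : forall t, (ek t < n)%N.
Hypothesis dbx : forall t x y, is_derive (x : R) (1 : R) (b t ^~ y) (bx t x y).
Hypothesis dby : forall t x y, is_derive (y : R) (1 : R) (b t x) (bY t x y).

Definition magnetic_transport e x y p q : R :=
  let u := p - gauge1 e x y in let v := q - gauge2 e x y in
  \sum_t ((u * bx t x y + v * bY t x y) * (p ^+ ei t * q ^+ ej t) * e ^+ ek t
    + b t x y * ((u * gauge1x e x y + v * gauge2x e x y) *
                   (p ^+ (ei t).-1 * q ^+ ej t *+ ei t)
               + (u * gauge1y e x y + v * gauge2y e x y) *
                   (p ^+ ei t * q ^+ (ej t).-1 *+ ej t)) * e ^+ ek t).

Hypothesis transport : forall e x y p q, magnetic_transport e x y p q = 0.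

Let pD := @pifD R. Let pM := @pifM R. Let pC := @pif_cst R. Let pX := @pif_first R.

Let pifN (f : R -> R -> R) :
  polynomial_in_first f -> polynomial_in_first (fun x y => - f x y).
Proof. by move=> pf; apply: pif_ext (pM (pC (fun=> -1)) pf) => x y; rewrite mulN1r. Qed.

Let gauge_pif e : polynomial_in_first (gauge1 e) /\ polynomial_in_first (gauge1x e) /\
  polynomial_in_first (gauge1y e) /\ polynomial_in_first (gauge2 e) /\
  polynomial_in_first (gauge2x e) /\ polynomial_in_first (gauge2y e).
Proof.
by repeat split; rewrite /gauge1 /gauge1x /gauge1y /gauge2 /gauge2x /gauge2y;
  repeat first [apply: pifN|apply: pD|apply: pM|exact: pX|exact: (pC id)
               |exact: (pC (fun=> _))|exact: (pC (fun y => y * _))].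
Qed.

Let gauge_swap_pif e : polynomial_in_first (fun x y => gauge1 e y x) /\
  polynomial_in_first (fun x y => gauge1x e y x) /\
  polynomial_in_first (fun x y => gauge1y e y x) /\
  polynomial_in_first (fun x y => gauge2 e y x) /\
  polynomial_in_first (fun x y => gauge2x e y x) /\
  polynomial_in_first (fun x y => gauge2y e y x).
Proof.
by repeat split; rewrite /gauge1 /gauge1x /gauge1y /gauge2 /gauge2x /gauge2y;
  repeat first [apply: pifN|apply: pD|apply: pM|exact: pX|exact: (pC id)
               |exact: (pC (fun=> _))|exact: (pC (fun y => y ^+ 2))].
Qed.

Let fixed_e_bipolynomial e i j : bipolynomial
  (fun x y => \sum_(t | (ei t == i) && (ej t == j)) b t x y * e ^+ ek t).
Proof.
have [h1 [h2 [h3 [h4 [h5 h6]]]]] := gauge_pif e.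
have [k1 [k2 [k3 [k4 [k5 k6]]]]] := gauge_swap_pif e.
apply: (@killing_coefficient_bipolynomial R I n ei ej
  (fun t x y => b t x y * e ^+ ek t) (fun t x y => bx t x y * e ^+ ek t)
  (fun t x y => bY t x y * e ^+ ek t) (gauge1 e) (gauge2 e) (gauge1x e) (gauge1y e)
  (gauge2x e) (gauge2y e)) => //.
- by move=> t x y; exact: is_derive_mulr.
- by move=> t x y; exact: is_derive_mulr.
move=> x y p q; rewrite -[RHS](transport e x y p q).
by apply: eq_bigr => t _; ring.
Qed.

Let J : finType := ('I_n * 'I_n * 'I_n)%type.
Let i_lt t : (ei t < n)%N. Proof. by have := e_lt t; lia. Qed.
Let j_lt t : (ej t < n)%N. Proof. by have := e_lt t; lia. Qed.
Let key t : J := (Ordinal (i_lt t), Ordinal (j_lt t), Ordinal (ek_lt t)).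
Let a (c : I -> R -> R -> R) (k : J) x y : R := \sum_(t | key t == k) c t x y.

(** Polynomiality is known for each value of e after summing over the powers of e. Lagrange
    interpolation at e = 0, ..., n - 1 recovers the coefficient of a single power as a linear
    combination of such sums. *)
Let key_bipolynomial (k : J) : bipolynomial (a b k).
Proof.
have H (l : 'I_n) := fixed_e_bipolynomial l%:R k.1.1 k.1.2.
have [P HP] := bipolynomial_lincomb (fun l : 'I_n => (lagrange_basis l : {poly R})`_k.2) H.
exists P => x y; rewrite -HP.
pose p : {poly R} := \poly_(l < n)
  (\sum_(t | (ei t == k.1.1) && (ej t == k.1.2) && (ek t == l)) b t x y).
have pe e : p.[e] = \sum_(t | (ei t == k.1.1) && (ej t == k.1.2)) b t x y * e ^+ ek t.
  rewrite /p horner_poly (partition_big (fun t => Ordinal (ek_lt t)) predT) //=.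
  apply: eq_bigr => l _; rewrite mulr_suml.
  by apply: eq_big => t; [rewrite -val_eqE|move=> /andP[_ /eqP ->]].
have -> : a b k x y = p`_k.2.
  rewrite coef_poly ltn_ord /a; apply: eq_bigl => t.
  by case: k {H P HP p pe} => -[? ?] ?; rewrite /key !xpair_eqE -!val_eqE.
rewrite [in LHS](lagrange_interpolation (size_poly _ _ : (size p <= n)%N)) coef_sum.
by apply: eq_bigr => l _; rewrite coefCM pe.
Qed.

Let regroup (c : I -> R -> R -> R) (W : nat -> nat -> nat -> R) x y :
  \sum_t c t x y * W (ei t) (ej t) (ek t) = \sum_(k : J) a c k x y * W k.1.1 k.1.2 k.2.
Proof.
rewrite (partition_big key predT) //=; apply: eq_bigr => k _; rewrite mulr_suml.
by apply: eq_bigr => t /eqP <-.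
Qed.

Definition momentum_function e x y p q : R :=
  \sum_t b t x y * (p ^+ ei t * q ^+ ej t * e ^+ ek t).

Hypotheses (p40 : p4 != 0) (p50 : p5 != 0).
Let g2 : R := p4 ^+ 2 + p5 ^+ 2.
Let g2_gt0 : 0 < g2.
Proof. by rewrite ltr_pwDl ?sqr_ge0 // lt0r sqrf_eq0 p40 sqr_ge0. Qed.
Let g20 : g2 != 0. Proof. exact: lt0r_neq0. Qed.
(** Solving b = p3 + p4 x + p5 y and s = p5 x - p4 y gives x = [cb] b + [cg] + [cs] s. The map (x,
    y) -> (b, s) scales squared lengths by [g2], so U^2 + V^2 = [g2] (u^2 + v^2). *)
Let cb : R := p4 / g2.
Let cg : R := - (p3 * p4 / g2).
Let cs : R := p5 / g2.

Let xz (z : level_point) := pt_x cb cg cs z.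
Let yz (z : level_point) : R := (p5 * (pt_b z - p3) - p4 * pt_s z) / g2.
Let uz (z : level_point) : R := (p5 * pt_U z + p4 * pt_V z) / g2.
Let vz (z : level_point) : R := (p5 * pt_V z - p4 * pt_U z) / g2.

Section FixedLevel.
Variable h : R.
Let rep := level_pair h cb cg cs.
Let repP : derivation_rep (on_level h) rep := level_pairP h cb cg cs.

Let rep_x : rep xz uz.
Proof.
apply: (rep_eq repP) (repD repP (repD repP (repZ repP cb (level_pair_b h cb cg cs))
  (rep_cst repP cg)) (repZ repP cs (level_pair_s h cb cg cs))) => z _ //.
by rewrite /uz /cb /cs; field.
Qed.

Let rep_y : rep yz vz.
Proof.
apply: (rep_eq repP) (repD repP (repD repP (repZ repP (p5 / g2) (level_pair_b h cb cg cs))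
  (rep_cst repP (- (p5 * p3 / g2)))) (repZ repP (- (p4 / g2)) (level_pair_s h cb cg cs)))
  => z _.
  by rewrite /yz; field.
by rewrite /vz; field.
Qed.

Let B z := pt_B cb cg cs z.

Let rep_u : rep uz (fun z => - (B z * vz z)).
Proof.
apply: (rep_eq repP) (repD repP (repZ repP (p5 / g2) (level_pair_U h cb cg cs))
  (repZ repP (p4 / g2) (level_pair_V h cb cg cs))) => z _.
  by rewrite /uz; field.
by rewrite /vz /B; field.
Qed.

Let rep_v : rep vz (fun z => B z * uz z).
Proof.
apply: (rep_eq repP) (repD repP (repZ repP (p5 / g2) (level_pair_V h cb cg cs))
  (repZ repP (- (p4 / g2)) (level_pair_U h cb cg cs))) => z _.
  by rewrite /vz; field.
by rewrite /uz /B; field.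
Qed.

Let rep_e : rep pt_e (fun=> 0) := level_pair_e h cb cg cs.

Let pz z := uz z + gauge1 (pt_e z) (xz z) (yz z).
Let qz z := vz z + gauge2 (pt_e z) (xz z) (yz z).

(** The field is the curl of the gauge potentials, so it cancels from the derivatives of the
    canonical momenta. *)
Let Bxy z : B z = gauge1y (pt_e z) (xz z) (yz z) - gauge2x (pt_e z) (xz z) (yz z).
Proof.
rewrite /B /pt_B -/(xz z) /gauge1y /gauge2x.
have -> : pt_b z = p3 + xz z * p4 + yz z * p5.
  by rewrite /xz /pt_x /yz /cb /cg /cs /g2; field.
by field.
Qed.

Let rep_p : rep pz (fun z => uz z * gauge1x (pt_e z) (xz z) (yz z)
  + vz z * gauge2x (pt_e z) (xz z) (yz z)).
Proof.
have rxy := repM repP rep_x rep_y.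
apply: (rep_eq repP) (repD repP rep_u (repD repP (repD repP
  (repZ repP (2^-1 * p3) rep_y) (repZ repP p4 rxy))
  (repZ repP 2^-1 (repM repP (repM repP rep_x rxy) rep_e)))) => z _.
  by rewrite /pz /gauge1; ring.
by rewrite Bxy /gauge1x /gauge1y /gauge2x; field.
Qed.

Let rep_q : rep qz (fun z => uz z * gauge1y (pt_e z) (xz z) (yz z)
  + vz z * gauge2y (pt_e z) (xz z) (yz z)).
Proof.
have rxy := repM repP rep_x rep_y.
apply: (rep_eq repP) (repD repP rep_v (repD repP
  (repZ repP (- (2^-1 * p3)) rep_x) (repZ repP (- p5) rxy))) => z _.
  by rewrite /qz /gauge2; ring.
by rewrite Bxy /gauge1y /gauge2x /gauge2y; field.
Qed.

Let Fz z := momentum_function (pt_e z) (xz z) (yz z) (pz z) (qz z).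

Let rep_F : rep Fz (fun=> 0).
Proof.
have rk (k : J) := rep_bipolynomial repP (key_bipolynomial k)
  (fun x y => is_derive_bigsum (index_enum I) (fun t => key t == k) (fun t => dbx t x y))
  (fun x y => is_derive_bigsum (index_enum I) (fun t => key t == k) (fun t => dby t x y))
  rep_x rep_y.
have rW (k : J) := repM repP (repM repP (rep_exp repP k.1.1 rep_p)
  (rep_exp repP k.1.2 rep_q)) (rep_exp repP k.2 rep_e).
apply: (rep_eq repP) (rep_sum repP (index_enum J) (fun k _ => repM repP (rk k) (rW k))) => z _.
  rewrite /Fz /momentum_function.
  by rewrite (regroup b (fun i j k => pz z ^+ i * qz z ^+ j * pt_e z ^+ k)).
rewrite -[RHS](transport (pt_e z) (xz z) (yz z) (pz z) (qz z)) /magnetic_transport.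
have -> : pz z - gauge1 (pt_e z) (xz z) (yz z) = uz z by rewrite /pz addrK.
have -> : qz z - gauge2 (pt_e z) (xz z) (yz z) = vz z by rewrite /qz addrK.
move: (pz z) (qz z) (xz z) (yz z) (uz z) (vz z) (pt_e z) => p q x y u v e.
rewrite [RHS](eq_bigr (fun t => bx t x y * (u * (p ^+ ei t * q ^+ ej t) * e ^+ ek t)
  + (bY t x y * (v * (p ^+ ei t * q ^+ ej t) * e ^+ ek t)
  + b t x y * (((u * gauge1x e x y + v * gauge2x e x y) * (p ^+ (ei t).-1 * q ^+ ej t *+ ei t)
       + (u * gauge1y e x y + v * gauge2y e x y) * (p ^+ ei t * q ^+ (ej t).-1 *+ ej t))
       * e ^+ ek t)))); last by move=> t _; ring.
rewrite [RHS]big_split [X in _ = _ + X]big_split /=.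
rewrite (regroup bx (fun i j k => u * (p ^+ i * q ^+ j) * e ^+ k)).
rewrite (regroup bY (fun i j k => v * (p ^+ i * q ^+ j) * e ^+ k)).
rewrite (regroup b (fun i j k => ((u * gauge1x e x y + v * gauge2x e x y) * (p ^+ i.-1 * q ^+ j *+ i)
       + (u * gauge1y e x y + v * gauge2y e x y) * (p ^+ i * q ^+ j.-1 *+ j)) * e ^+ k)).
rewrite -!big_split; apply: eq_bigr => k _.
rewrite -/(a bx k x y) -/(a bY k x y) -/(a b k x y).
by rewrite mulr0 mul0rn mulr0 addr0 /=; ring.
Qed.

Hypothesis h0 : 0 < h.

Lemma momentum_function_on_level : exists c : R -> R,
  forall z, on_level h z -> Fz z = c (pt_e z).
Proof.
apply: (level_integral_constant h0 _ _ rep_F); rewrite mulf_neq0 ?invr_neq0 //.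
Qed.

Lemma momentum_function_level_eq e x y u v : g2 * (u ^+ 2 + v ^+ 2) = h ->
  exists2 z, on_level h z & pt_e z = e /\
    Fz z = momentum_function e x y (u + gauge1 e x y) (v + gauge2 e x y).
Proof.
move=> eh; pose bb := p3 + p4 * x + p5 * y.
pose z := LevelPoint (p5 * x - p4 * y) bb
  (p5 * u - p4 * v + 2^-1 * bb ^+ 2) (p4 * u + p5 * v) e.
have eU : pt_U z = p5 * u - p4 * v by rewrite /pt_U /= addrK.
exists z; first by rewrite /on_level eU /= -eh /g2; ring.
split=> //; rewrite /Fz /pz /qz.
have -> : xz z = x by rewrite /xz /pt_x /cb /cg /cs /= /bb /g2; field.
have -> : yz z = y by rewrite /yz /= /bb /g2; field.
have -> : uz z = u by rewrite /uz eU /= /g2; field.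
by have -> : vz z = v by rewrite /vz eU /= /g2; field.
Qed.

End FixedLevel.

(** The constant on a level depends on e alone, so the base point and the direction of the velocity
    may be moved freely. *)
Lemma momentum_function_level_invariant e x y u v x' y' u' v' :
  u ^+ 2 + v ^+ 2 = u' ^+ 2 + v' ^+ 2 -> 0 < u ^+ 2 + v ^+ 2 ->
  momentum_function e x y (u + gauge1 e x y) (v + gauge2 e x y)
  = momentum_function e x' y' (u' + gauge1 e x' y') (v' + gauge2 e x' y').
Proof.
move=> euv uv0; have h0 := mulr_gt0 g2_gt0 uv0.
have [c H] := momentum_function_on_level h0.
have [z zh [ez <-]] := @momentum_function_level_eq _ e x y u v erefl.
have [|z' zh' [ez' <-]] := @momentum_function_level_eq (g2 * (u ^+ 2 + v ^+ 2)) e x' y' u' v'.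
  by rewrite euv.
by rewrite (H z zh) (H z' zh') ez ez'.
Qed.

End PlanarMagneticFlow.

(** * A cube is not a null set *)

Section CubeNotNull.
Context {R : realType}.

Definition itv_indicator (l u t : R) : R := ((l <= t <= u)%R)%:R.

(** Integrate over [1, 2], term by term by nonnegativity; the indicator of an interval has integral
    at most its length. *)
Lemma weighted_interval_cover (c l u : nat -> R) :
  (forall k, 0 <= c k) -> (forall k, l k <= u k) ->
  (forall t, 1 <= t <= 2 ->
     (1%E <= \sum_(0 <= k <oo) (c k * itv_indicator (l k) (u k) t)%:E)%E) ->
  (1%E <= \sum_(0 <= k <oo) (c k * (u k - l k))%:E)%E.
Proof.
move=> c0 lu H; pose mu := @lebesgue_measure R.
pose D : set (measurableTypeR R) := `[1, 2]%classic.
have mD : measurable D by exact: measurable_itv.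
pose A k : set (measurableTypeR R) := `[l k, u k]%classic.
have mA k : measurable (A k) by exact: measurable_itv.
pose f k (t : measurableTypeR R) : \bar R := (c k * \1_(A k) t)%:E.
have f0 k t : (0 <= f k t)%E by rewrite lee_fin mulr_ge0.
have mf k : measurable_fun D (f k).
  apply/measurable_EFinP; apply: measurable_funM; first exact: measurable_cst.
  exact/measurable_indic.
have fE k t : f k t = (c k * itv_indicator (l k) (u k) t)%:E.
  rewrite /f indicE /itv_indicator; congr (_ * (nat_of_bool _)%:R)%:E.
  by apply/idP/idP; rewrite inE /A /= in_itv.
have itv_len (a b : R) : a <= b -> mu `[a, b]%classic = (b - a)%:E.
  move=> ab; rewrite /mu lebesgue_measure_itv /=; case: ltP => //.
  by rewrite lee_fin => ba; rewrite (@le_anti _ _ a b) ?ab // subrr.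
have int_f k : (\int[mu]_(t in D) f k t <= (c k * (u k - l k))%:E)%E.
  rewrite /f; under eq_integral do rewrite EFinM.
  rewrite ge0_integralZl_EFin //.
  - rewrite EFinM; apply: lee_wpmul2l; first by rewrite lee_fin.
    rewrite integral_indic // -itv_len //.
    by apply: le_measure; rewrite ?inE //; exact: measurableI.
  - by apply/measurable_EFinP; exact/measurable_indic.
apply: (@le_trans _ _ (\sum_(0 <= k <oo) \int[mu]_(t in D) f k t)%E); last first.
  apply: lee_nneseries => [k _ _|k _]; last exact: int_f.
  exact: integral_ge0.
rewrite -integral_nneseries //.
apply: (@le_trans _ _ (\int[mu]_(t in D) (cst 1%E t))%E).
  have e : mu D = (2 - 1)%:E by apply: itv_len; lra.
  by rewrite integral_cst // mul1e [leRHS]e lee_fin; lra.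
apply: ge0_le_integral => //.
- exact: ge0_emeasurable_sum.
move=> t; rewrite /D /= in_itv /= => t12; rewrite (eq_eseriesr (fun k _ => fE k t)).
exact: H.
Qed.

(** The weights carry the induction: integrating out the last coordinate moves its side length into
    the weight. This is Fubini one variable at a time, with no product measure. *)
Lemma weighted_cube_cover n (c : nat -> R) (l u : nat -> nat -> R) :
  (forall k, 0 <= c k) -> (forall k i, l k i <= u k i) ->
  (forall z : nat -> R, (forall i, 1 <= z i <= 2) ->
     (1%E <= \sum_(0 <= k <oo)
        (c k * \prod_(i < n) itv_indicator (l k i) (u k i) (z i))%:E)%E) ->
  (1%E <= \sum_(0 <= k <oo) (c k * \prod_(i < n) (u k i - l k i))%:E)%E.
Proof.
elim: n c => [|n IH] c c0 lu H.
  have /H : forall i : nat, 1 <= (1 : R) <= 2 by move=> _; lra.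
  have e (w : nat -> nat -> R) :
      (\sum_(0 <= k <oo) (c k * \prod_(i < 0) w k i)%:E = \sum_(0 <= k <oo) (c k)%:E)%E.
    by apply: eq_eseriesr => k _; rewrite big_ord0 mulr1.
  move=> H1; rewrite (e (fun k i => u k i - l k i)); apply: le_trans H1 _.
  by rewrite (e (fun k i => itv_indicator (l k i) (u k i) 1)).
under eq_eseriesr do rewrite big_ord_recr /= mulrCA mulrC.
apply: IH => //.
  by move=> k; rewrite mulr_ge0 // subr_ge0.
move=> z z12.
under eq_eseriesr do rewrite mulrAC.
apply: weighted_interval_cover => // [k|t t12].
  by rewrite mulr_ge0 // prodr_ge0 // => i _; rewrite /itv_indicator ler0n.
(* The first n coordinates are frozen and their indicators join the weight; only the last coordinate
   varies. *)
have := H (fun i => if i == n then t else z i).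
under eq_eseriesr do rewrite big_ord_recr /= eqxx mulrA.
move=> /(_ _) H'; apply: le_trans (H' _) _ => [i|]; first by case: ifP.
rewrite le_eqVlt; apply/orP; left; apply/eqP; apply: eq_eseriesr => k _.
congr (_ * _ * _)%:E; apply: eq_bigr => i _; by rewrite ltn_eqF.
Qed.

Lemma cube_not_null n (A : set 'rV[R]_n.+1) :
  (forall z : 'rV[R]_n.+1, (forall i, 1 <= z 0 i <= 2) -> A z) -> ~ lebesgue_null A.
Proof.
move=> HA /(_ 2^-1); rewrite invr_gt0 ltr0n => /(_ isT)[l [u [lu cov vol]]].
have := @weighted_cube_cover n.+1 (fun=> 1) (fun k i => l k 0 (inord i))
  (fun k i => u k 0 (inord i)) (fun=> ler01) (fun k i => lu k (inord i)).
have -> : (\sum_(0 <= k <oo) (1 * \prod_(i < n.+1) (u k 0 (inord i) - l k 0 (inord i)))%:E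
  = \sum_(0 <= k <oo) (\prod_i (u k 0 i - l k 0 i))%:E)%E.
  apply: eq_eseriesr => k _; rewrite mul1r; congr _%:E.
  by apply: eq_bigr => i _; rewrite inord_val.
move=> H; suff : (1%E <= (2^-1 : R)%:E)%E by rewrite lee_fin; lra.
apply: le_trans vol; apply: H => z z12.
have /cov [k _ Hk] : A (\row_i z i) by apply: HA => i; rewrite mxE.
have nn j : (0 <= (1 * \prod_(i < n.+1) itv_indicator (l j 0 (inord i)) (u j 0 (inord i)) (z i))%:E :> \bar R)%E.
  by rewrite lee_fin mul1r prodr_ge0 // => i _; rewrite /itv_indicator ler0n.
(* The point lies in box k, whose term equals 1; all other terms are nonnegative. *)
rewrite (nneseries_split 0 k.+1) //.
rewrite add0n big_nat_recr //= -[leLHS]add0e addeAC.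
apply: leeD; first by apply: adde_ge0; [exact: sume_ge0|exact: nneseries_ge0].
rewrite mul1r big1 // => i _; rewrite /itv_indicator.
by have := Hk (inord i); rewrite mxE inordK // => ->.
Qed.

End CubeNotNull.

(** * The Poisson bracket with H *)

Section CoordinateLines.
Context {R : realType}.

(** A directional derivative depends only on the restriction to a line, so it can be transferred
    between different spaces, such as a row space and R. *)
Lemma is_derive_along (V W : normedModType R) (f : V -> R) (g : W -> R) a v x w d :
  (forall h : R, g (h *: w + x) = f (h *: v + a)) ->
  is_derive a v f d -> is_derive x w g d.
Proof.
move=> gf [df Df].
have e : (fun h : R => h^-1 *: ((g \o shift x) (h *: w) - g x))
       = (fun h : R => h^-1 *: ((f \o shift a) (h *: v) - f a)).
  apply/funext => h /=; congr (_ *: (_ - _)); first exact: gf.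
  by have := gf 0; rewrite !scale0r !add0r.
by apply: DeriveDef; [rewrite /derivable e|rewrite /derive e].
Qed.

Definition coordinate_line n (z : 'rV[R]_n) (j : 'I_n) (t : R) : 'rV[R]_n :=
  z + (t - z 0 j) *: delta_mx 0 j.

Lemma coordinate_lineE n (z : 'rV[R]_n) j t i :
  coordinate_line z j t 0 i = if i == j then t else z 0 i.
Proof.
rewrite !mxE eqxx /=; case: eqP => [->|_]; last by rewrite mulr0 addr0.
by rewrite mulr1 addrC subrK.
Qed.

Lemma partial_line n (f : 'rV[R]_n -> R) (z : 'rV[R]_n) j d :
  is_derive (z 0 j) (1 : R) (fun t => f (coordinate_line z j t)) d ->
  partial j f z = d.
Proof.
move=> H; have [_ <-] // : is_derive z (delta_mx 0 j) f d.
apply: is_derive_along H => h /=; rewrite /coordinate_line; congr f.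
by rewrite -[h *: (1 : R)]/(h * 1) mulr1 addrK addrC.
Qed.

Lemma partial_line_cst n (f : 'rV[R]_n -> R) (z : 'rV[R]_n) j :
  (forall t, f (coordinate_line z j t) = f z) -> partial j f z = 0.
Proof.
move=> H; apply: partial_line; rewrite (_ : (fun t => _) = cst (f z)).
  exact: is_derive_cst.
by apply/funext => t; rewrite H.
Qed.

End CoordinateLines.

Section PoissonTransport.
Context {R : realType}.
Implicit Type z : 'rV[R]_(6 + 6).

Lemma xc_line k i z t : xc k (coordinate_line z (lshift 6 i) t)
  = if i == inord k.-1 then t else xc k z.
Proof. by rewrite /xc coordinate_lineE (inj_eq (@lshift_inj _ _)) eq_sym. Qed.

Lemma pc_line k i z t : pc k (coordinate_line z (rshift 6 i) t)
  = if i == inord k.-1 then t else pc k z.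
Proof. by rewrite /pc coordinate_lineE (inj_eq (@rshift_inj _ _)) eq_sym. Qed.

Lemma xc_line_p k i z t : xc k (coordinate_line z (rshift 6 i) t) = xc k z.
Proof. by rewrite /xc coordinate_lineE eq_lrshift. Qed.

Lemma pc_line_x k i z t : pc k (coordinate_line z (lshift 6 i) t) = pc k z.
Proof. by rewrite /pc coordinate_lineE eq_rlshift. Qed.

Lemma omega1E z : omega1 z = pc 1 z - gauge1 (pc 3 z) (pc 4 z) (pc 6 z) (xc 1 z) (xc 2 z).
Proof. by rewrite /omega1 /gauge1; ring. Qed.
Lemma omega2E z : omega2 z = pc 2 z - gauge2 (pc 3 z) (pc 5 z) (pc 6 z) (xc 1 z) (xc 2 z).
Proof. by rewrite /omega2 /gauge2; ring. Qed.

Let inord_eq (i j : nat) : (i < 6)%N -> (j < 6)%N ->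
  (inord i == inord j :> 'I_6) = (i == j).
Proof. by move=> hi hj; rewrite -val_eqE /= !inordK. Qed.

Lemma is_derive_half_squares (f g : R -> R) x f' g' :
  is_derive x (1 : R) f f' -> is_derive x (1 : R) g g' ->
  is_derive x (1 : R) (fun t => 2^-1 * (f t ^+ 2 + g t ^+ 2)) (f x * f' + g x * g').
Proof.
move=> df dg.
rewrite (_ : (fun t => _) = 2^-1 *: (f * f + g * g)); last by apply/funext.
have -> : f x * f' + g x * g' = 2^-1 *: ((f x *: f' + f x *: f') + (g x *: g' + g x *: g')).
  by rewrite -![_ *: _]/(_ * _); field.
exact: (is_deriveZ _ (is_deriveD (is_deriveM df df) (is_deriveM dg dg))).
Qed.

Lemma is_derive_quadratic (c0 c1 c2 x : R) :
  is_derive x (1 : R) (fun t => c0 + c1 * t + c2 * t ^+ 2) (c1 + 2 * c2 * x).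
Proof.
pose p : {poly R} := c0%:P + c1%:P * 'X + c2%:P * ('X * 'X).
have dp : deriv p = c1%:P + c2%:P * ('X + 'X).
  by rewrite /p !derivD !derivM !derivC derivX; ring.
rewrite (_ : (fun t => _) = horner p); last first.
  by apply/funext => t; rewrite /p !(hornerD, hornerM, hornerC, hornerX).
apply: is_derive_eq (is_derive_horner p x) _.
by rewrite dp !(hornerD, hornerM, hornerC, hornerX); ring.
Qed.

Let quad (f : R -> R) c0 c1 c2 x d : (forall t, f t = c0 + c1 * t + c2 * t ^+ 2) ->
  d = c1 + 2 * c2 * x -> is_derive x (1 : R) f d.
Proof.
move=> ef ->; rewrite (_ : f = fun t => c0 + c1 * t + c2 * t ^+ 2).
  exact: is_derive_quadratic.
exact/funext.
Qed.

Lemma partial_H_line z j f f' g g' d : d = omega1 z * f' + omega2 z * g' ->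
  (forall t, omega1 (coordinate_line z j t) = f t) ->
  (forall t, omega2 (coordinate_line z j t) = g t) ->
  is_derive (z 0 j) (1 : R) f f' -> is_derive (z 0 j) (1 : R) g g' ->
  partial j H z = d.
Proof.
move=> -> ef eg df dg; apply: partial_line.
rewrite (_ : (fun t => _) = (fun t => 2^-1 * (f t ^+ 2 + g t ^+ 2))); last first.
  by apply/funext => t; rewrite /H ef eg.
have zj : coordinate_line z j (z 0 j) = z.
  by rewrite /coordinate_line subrr scale0r addr0.
rewrite -[in omega1 z]zj ef -[in omega2 z]zj eg.
exact: is_derive_half_squares.
Qed.

Lemma partial_H_p1 z : partial (rshift 6 (inord 0)) H z = omega1 z.
Proof.
apply: (@partial_H_line z _ (fun t => t - gauge1 (pc 3 z) (pc 4 z) (pc 6 z) (xc 1 z) (xc 2 z))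
  1 (fun t => omega2 z) 0).
- by rewrite mulr1 mulr0 addr0.
- by move=> t; rewrite omega1E !pc_line !xc_line_p /= !inord_eq.
- by move=> t; rewrite !omega2E !pc_line !xc_line_p /= !inord_eq.
- by apply: (quad (c0 := - gauge1 (pc 3 z) (pc 4 z) (pc 6 z) (xc 1 z) (xc 2 z))
    (c1 := 1) (c2 := 0)) => [t|]; ring.
Qed.

Lemma partial_H_p2 z : partial (rshift 6 (inord 1)) H z = omega2 z.
Proof.
apply: (@partial_H_line z _ (fun t => omega1 z)
  0 (fun t => t - gauge2 (pc 3 z) (pc 5 z) (pc 6 z) (xc 1 z) (xc 2 z)) 1).
- by rewrite mulr1 mulr0 add0r.
- by move=> t; rewrite !omega1E !pc_line !xc_line_p /= !inord_eq.
- by move=> t; rewrite !omega2E !pc_line !xc_line_p /= !inord_eq.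
- by apply: (quad (c0 := - gauge2 (pc 3 z) (pc 5 z) (pc 6 z) (xc 1 z) (xc 2 z))
    (c1 := 1) (c2 := 0)) => [t|]; ring.
Qed.

Lemma partial_H_x1 z : partial (lshift 6 (inord 0)) H z =
  - (omega1 z * gauge1x (pc 4 z) (pc 6 z) (xc 1 z) (xc 2 z)
     + omega2 z * gauge2x (pc 3 z) (pc 5 z) (pc 6 z) (xc 1 z) (xc 2 z)).
Proof.
apply: (@partial_H_line z _
  (fun t => pc 1 z - gauge1 (pc 3 z) (pc 4 z) (pc 6 z) t (xc 2 z))
  (- gauge1x (pc 4 z) (pc 6 z) (xc 1 z) (xc 2 z))
  (fun t => pc 2 z - gauge2 (pc 3 z) (pc 5 z) (pc 6 z) t (xc 2 z))
  (- gauge2x (pc 3 z) (pc 5 z) (pc 6 z) (xc 1 z) (xc 2 z))).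
- by ring.
- by move=> t; rewrite !omega1E !pc_line_x !xc_line /= !inord_eq.
- by move=> t; rewrite !omega2E !pc_line_x !xc_line /= !inord_eq.
- apply: (quad (c0 := pc 1 z - 2^-1 * (xc 2 z * pc 3 z)) (c1 := - (xc 2 z * pc 4 z))
    (c2 := - (2^-1 * (xc 2 z * pc 6 z)))) => [t|]; rewrite /gauge1 /gauge1x -?[z 0 _]/(xc 1 z); by field.
apply: (quad (c0 := pc 2 z) (c1 := 2^-1 * pc 3 z + xc 2 z * pc 5 z) (c2 := 0)) => [t|];
  rewrite /gauge2 /gauge2x; by field.
Qed.

Lemma partial_H_x2 z : partial (lshift 6 (inord 1)) H z =
  - (omega1 z * gauge1y (pc 3 z) (pc 4 z) (pc 6 z) (xc 1 z) (xc 2 z)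
     + omega2 z * gauge2y (pc 5 z) (pc 6 z) (xc 1 z) (xc 2 z)).
Proof.
apply: (@partial_H_line z _
  (fun t => pc 1 z - gauge1 (pc 3 z) (pc 4 z) (pc 6 z) (xc 1 z) t)
  (- gauge1y (pc 3 z) (pc 4 z) (pc 6 z) (xc 1 z) (xc 2 z))
  (fun t => pc 2 z - gauge2 (pc 3 z) (pc 5 z) (pc 6 z) (xc 1 z) t)
  (- gauge2y (pc 5 z) (pc 6 z) (xc 1 z) (xc 2 z))).
- by ring.
- by move=> t; rewrite !omega1E !pc_line_x !xc_line /= !inord_eq.
- by move=> t; rewrite !omega2E !pc_line_x !xc_line /= !inord_eq.
- apply: (quad (c0 := pc 1 z) (c1 := - (2^-1 * pc 3 z + xc 1 z * pc 4 z
    + 2^-1 * (xc 1 z ^+ 2 * pc 6 z))) (c2 := 0)) => [t|]; rewrite /gauge1 /gauge1y; by field.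
apply: (quad (c0 := pc 2 z + 2^-1 * (xc 1 z * pc 3 z)) (c1 := xc 1 z * pc 5 z) (c2 := 0))
  => [t|]; rewrite /gauge2 /gauge2y; by field.
Qed.

Lemma partial_H_x z i : i != inord 0 -> i != inord 1 -> partial (lshift 6 i) H z = 0.
Proof.
move=> /negPf i0 /negPf i1; apply: partial_line_cst => t.
by rewrite /H !omega1E !omega2E !pc_line_x !xc_line /= i0 i1.
Qed.

End PoissonTransport.

Section HomogeneousIntegral.
Context {R : realType}.
Variables (d : nat) (a : multiindex d -> 'rV[R]_2 -> R).
Hypothesis a_smooth : forall t, mlength t = d -> smooth (a t).

Definition base_point (x y : R) : 'rV[R]_2 := \row_(i < 2) [:: x; y]`_i.

(** With p3, p4, p5 frozen, their powers are absorbed into the coefficient. The value 0 outside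
    length [d], where [f t] may fail to be smooth, permits differentiation for every index. *)
Definition base_coef (p3 p4 p5 : R) (f : multiindex d -> 'rV[R]_2 -> R)
    (t : multiindex d) (x y : R) : R :=
  if mlength t == d then f t (base_point x y) *
    (p3 ^+ t (inord 2) * p4 ^+ t (inord 3) * p5 ^+ t (inord 4)) else 0.

Let exi (k : nat) (t : multiindex d) : nat := t (inord k).

Lemma prod_ord6 (G : 'I_6 -> R) : \prod_(i < 6) G i =
  G (inord 0) * (G (inord 1) * (G (inord 2) * (G (inord 3) * (G (inord 4) * G (inord 5))))).
Proof.
rewrite !big_ord_recl big_ord0 mulr1.
by do 5?[congr (G _ * _); first by apply: val_inj; rewrite /= inordK];
  congr G; apply: val_inj; rewrite /= inordK.
Qed.

Lemma hom_in_momentaE z : hom_in_momenta a z =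
  momentum_function (exi 0) (exi 1) (exi 5) (base_coef (pc 3 z) (pc 4 z) (pc 5 z) a)
    (pc 6 z) (xc 1 z) (xc 2 z) (pc 1 z) (pc 2 z).
Proof.
rewrite /hom_in_momenta /momentum_function big_mkcond /=; apply: eq_bigr => t _.
rewrite /base_coef; case: ifP => _; last by rewrite mul0r.
have -> : \row_(i < 2) xc i.+1 z = base_point (xc 1 z) (xc 2 z).
  by apply/rowP => i; rewrite !mxE; case: i => [[|[|]]].
rewrite /mom_monomial prod_ord6 !inordK // /exi; ring.
Qed.

Lemma is_derive_base_x p3 p4 p5 t x y : is_derive (x : R) (1 : R)
  (base_coef p3 p4 p5 a t ^~ y) (base_coef p3 p4 p5 (fun t => partial ord0 (a t)) t x y).
Proof.
rewrite /base_coef; case: eqP => [/a_smooth/(_ 1%N) /= sm|_]; last exact: is_derive_cst.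
have da : is_derive (x : R) (1 : R) (fun x => a t (base_point x y))
    (partial ord0 (a t) (base_point x y)).
  apply: (@is_derive_along _ _ _ _ _ (base_point x y) (delta_mx 0 ord0)); last first.
    by apply: derivableP; have [+ _] := sm ord0; apply.
  move=> h /=; congr (a t); apply/rowP => i; rewrite !mxE.
  by case: i => [[|[|]]] //= _; rewrite ?mulr1 ?mulr0 ?add0r // -[h *: _]/(h * 1) mulr1.
exact: is_derive_mulr.
Qed.

Lemma is_derive_base_y p3 p4 p5 t x y : is_derive (y : R) (1 : R)
  (base_coef p3 p4 p5 a t x)
  (base_coef p3 p4 p5 (fun t => partial ord_max (a t)) t x y).
Proof.
rewrite (_ : base_coef p3 p4 p5 a t x = (fun y => base_coef p3 p4 p5 a t x y)) //.
rewrite /base_coef; case: eqP => [/a_smooth/(_ 1%N) /= sm|_]; last exact: is_derive_cst.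
have da : is_derive (y : R) (1 : R) (fun y => a t (base_point x y))
    (partial ord_max (a t) (base_point x y)).
  apply: (@is_derive_along _ _ _ _ _ (base_point x y) (delta_mx 0 ord_max)); last first.
    by apply: derivableP; have [+ _] := sm ord_max; apply.
  move=> h /=; congr (a t); apply/rowP => i; rewrite !mxE.
  by case: i => [[|[|]]] //= _; rewrite ?mulr1 ?mulr0 ?add0r // -[h *: _]/(h * 1) mulr1.
exact: is_derive_mulr.
Qed.

(** The index ranges over all of [multiindex d], where each entry alone is at most d; hence the
    bound 2 d. *)
Lemma exp_sum_lt t : (exi 0 t + exi 1 t < (d + d).+1)%N.
Proof. by rewrite ltnS leq_add // /exi -ltnS ltn_ord. Qed.

Lemma exp_lt t : (exi 5 t < (d + d).+1)%N.
Proof. by rewrite ltnS (leq_trans _ (leq_addr _ _)) // /exi -ltnS ltn_ord. Qed.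

Let F := hom_in_momenta a.
Let b z := base_coef (pc 3 z) (pc 4 z) (pc 5 z) a.
Let bx z := base_coef (pc 3 z) (pc 4 z) (pc 5 z) (fun t => partial ord0 (a t)).
Let bY z := base_coef (pc 3 z) (pc 4 z) (pc 5 z) (fun t => partial ord_max (a t)).

Let inord_eq (i j : nat) : (i < 6)%N -> (j < 6)%N ->
  (inord i == inord j :> 'I_6) = (i == j).
Proof. by move=> hi hj; rewrite -val_eqE /= !inordK. Qed.

Let mono z t : R := pc 1 z ^+ exi 0 t * pc 2 z ^+ exi 1 t * pc 6 z ^+ exi 5 t.

Lemma partial_F_x1 z : partial (lshift 6 (inord 0)) F z =
  \sum_t bx z t (xc 1 z) (xc 2 z) * mono z t.
Proof.
apply: partial_line.
rewrite (_ : (fun s => _) = fun s => \sum_t b z t s (xc 2 z) * mono z t); last first.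
  apply/funext => s; rewrite /F hom_in_momentaE !pc_line_x !xc_line /= !inord_eq //.
apply: is_derive_bigsum => t; apply: is_derive_mulr; exact: is_derive_base_x.
Qed.

Lemma partial_F_x2 z : partial (lshift 6 (inord 1)) F z =
  \sum_t bY z t (xc 1 z) (xc 2 z) * mono z t.
Proof.
apply: partial_line.
rewrite (_ : (fun s => _) = fun s => \sum_t b z t (xc 1 z) s * mono z t); last first.
  apply/funext => s; rewrite /F hom_in_momentaE !pc_line_x !xc_line /= !inord_eq //.
apply: is_derive_bigsum => t; apply: is_derive_mulr; exact: is_derive_base_y.
Qed.

Lemma is_derive_exp n (x : R) : is_derive x (1 : R) (fun t => t ^+ n) (x ^+ n.-1 *+ n).
Proof.
rewrite (_ : (fun t => _) = horner 'X^n); last by apply/funext => t; rewrite hornerXn.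
by apply: is_derive_eq (is_derive_horner _ _) _; rewrite derivXn hornerMn hornerXn.
Qed.

Lemma partial_F_p1 z : partial (rshift 6 (inord 0)) F z =
  \sum_t b z t (xc 1 z) (xc 2 z) *
    (pc 1 z ^+ (exi 0 t).-1 * pc 2 z ^+ exi 1 t *+ exi 0 t) * pc 6 z ^+ exi 5 t.
Proof.
apply: partial_line.
rewrite (_ : (fun s => _) = fun s => \sum_t s ^+ exi 0 t *
  (b z t (xc 1 z) (xc 2 z) * pc 2 z ^+ exi 1 t * pc 6 z ^+ exi 5 t)); last first.
  apply/funext => s; rewrite /F hom_in_momentaE !xc_line_p !pc_line /= !inord_eq //=.
  by apply: eq_bigr => t _; rewrite /b; ring.
rewrite (eq_bigr (fun t => (pc 1 z ^+ (exi 0 t).-1 *+ exi 0 t) *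
  (b z t (xc 1 z) (xc 2 z) * pc 2 z ^+ exi 1 t * pc 6 z ^+ exi 5 t))); last first.
  by move=> t _; ring.
apply: is_derive_bigsum => t; apply: is_derive_mulr; exact: is_derive_exp.
Qed.

Lemma partial_F_p2 z : partial (rshift 6 (inord 1)) F z =
  \sum_t b z t (xc 1 z) (xc 2 z) *
    (pc 1 z ^+ exi 0 t * pc 2 z ^+ (exi 1 t).-1 *+ exi 1 t) * pc 6 z ^+ exi 5 t.
Proof.
apply: partial_line.
rewrite (_ : (fun s => _) = fun s => \sum_t s ^+ exi 1 t *
  (b z t (xc 1 z) (xc 2 z) * pc 1 z ^+ exi 0 t * pc 6 z ^+ exi 5 t)); last first.
  apply/funext => s; rewrite /F hom_in_momentaE !xc_line_p !pc_line /= !inord_eq //=.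
  by apply: eq_bigr => t _; rewrite /b; ring.
rewrite (eq_bigr (fun t => (pc 2 z ^+ (exi 1 t).-1 *+ exi 1 t) *
  (b z t (xc 1 z) (xc 2 z) * pc 1 z ^+ exi 0 t * pc 6 z ^+ exi 5 t))); last first.
  by move=> t _; ring.
apply: is_derive_bigsum => t; apply: is_derive_mulr; exact: is_derive_exp.
Qed.

Lemma partial_F_x z i : i != inord 0 -> i != inord 1 -> partial (lshift 6 i) F z = 0.
Proof.
move=> /negPf i0 /negPf i1; apply: partial_line_cst => t.
by rewrite /F !hom_in_momentaE !pc_line_x !xc_line /= i0 i1.
Qed.

Lemma poisson_transport z : poisson H F z =
  magnetic_transport (pc 3 z) (pc 4 z) (pc 5 z) (exi 0) (exi 1) (exi 5)
    (b z) (bx z) (bY z) (pc 6 z) (xc 1 z) (xc 2 z) (pc 1 z) (pc 2 z).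
Proof.
(* Neither H nor F depends on x_3, ..., x_6, so only the first two canonical pairs contribute to the
   bracket. *)
have Fi i : (i != inord 0) && (i != inord 1) ->
    partial (rshift 6 i) H z * partial (lshift 6 i) F z
    - partial (lshift 6 i) H z * partial (rshift 6 i) F z = 0.
  move=> /andP[i0 i1].
  rewrite (partial_F_x _ i0 i1).
  rewrite (partial_H_x _ i0 i1).
  by rewrite mulr0 mul0r subrr.
have n01 : (inord 1 != inord 0 :> 'I_6) by rewrite inord_eq.
rewrite /poisson (bigD1 (inord 0)) //.
rewrite (bigD1 (inord 1)) /=; last exact: n01.
rewrite [X in _ + (_ + X)]big1; last exact: Fi.
rewrite [X in _ + X]addr0.
rewrite partial_H_p1 partial_H_p2 partial_H_x1 partial_H_x2.
rewrite partial_F_x1 partial_F_x2 partial_F_p1 partial_F_p2 /magnetic_transport.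
rewrite -omega1E -omega2E !mulr_sumr -!sumrB -big_split /=.
by apply: eq_bigr => t _; rewrite /mono /b; ring.
Qed.

End HomogeneousIntegral.

(** * Functional dependence *)

Section Dependence.
Context {R : realType}.

Section RegularAtPoint.
Variables (n : nat) (z : 'rV[R]_n.+1).
Implicit Types f g : 'rV[R]_n.+1 -> R.

(** Derivability in every direction does not imply continuity, which is what makes the conditions on
    p4, p5 and H open. *)
Definition regular_at f := {for z, continuous f} /\ forall v, derivable f z v.

Lemma regular_cst (c : R) : regular_at (fun=> c).
Proof. by split=> [|v]; [exact: cst_continuous|exact: derivable_cst]. Qed.

Lemma regularD f g : regular_at f -> regular_at g -> regular_at (fun y => f y + g y).
Proof.
move=> [cf df] [cg dg]; split=> [|v]; first exact: (continuousD cf cg).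
exact: (derivableD (df v) (dg v)).
Qed.

Lemma regularM f g : regular_at f -> regular_at g -> regular_at (fun y => f y * g y).
Proof.
move=> [cf df] [cg dg]; split=> [|v]; first exact: (continuousM cf cg).
exact: (derivableM (df v) (dg v)).
Qed.

Lemma regularB f g : regular_at f -> regular_at g -> regular_at (fun y => f y - g y).
Proof.
move=> [cf df] [cg dg]; split=> [|v]; first exact: (continuousB cf cg).
exact: (derivableB (df v) (dg v)).
Qed.

Lemma regularX f k : regular_at f -> regular_at (fun y => f y ^+ k).
Proof.
move=> rf; elim: k => [|k IH]; first exact: regular_cst.
rewrite (_ : (fun y => _) = (fun y => f y * f y ^+ k)); first exact: regularM.
by apply/funext => y; rewrite exprS.
Qed.

Lemma regular_coord i : regular_at (fun y => y 0 i).
Proof.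
split=> [|v]; first exact: coord_continuous.
have [] // : is_derive z v (fun y : 'rV[R]_n.+1 => y 0 i) (v 0 i).
apply: (@is_derive_along _ _ _ id _ (z 0 i) (v 0 i)) => h; by rewrite !mxE.
Qed.

End RegularAtPoint.

Local Notation reg := (@regular_at 11).

Lemma regular_xc k (z : 'rV[R]_(6 + 6)) : reg z (xc k).
Proof. exact: (@regular_coord 11 z (lshift 6 (inord k.-1 : 'I_6))). Qed.

Lemma regular_pc k (z : 'rV[R]_(6 + 6)) : reg z (pc k).
Proof. exact: (@regular_coord 11 z (rshift 6 (inord k.-1 : 'I_6))). Qed.

Lemma regular_omega1 (z : 'rV[R]_(6 + 6)) : reg z omega1.
Proof.
pose X k := regular_xc k z; pose P k := regular_pc k z; pose C c := @regular_cst 11 z c.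
exact: (regularB (regularB (regularB (P 1) (regularM (regularM (C 2^-1) (X 2)) (P 3)))
  (regularM (regularM (X 1) (X 2)) (P 4)))
  (regularM (regularM (regularM (C 2^-1) (regularX 2 (X 1))) (X 2)) (P 6))).
Qed.

Lemma regular_omega2 (z : 'rV[R]_(6 + 6)) : reg z omega2.
Proof.
pose X k := regular_xc k z; pose P k := regular_pc k z; pose C c := @regular_cst 11 z c.
exact: (regularD (regularD (P 2) (regularM (regularM (C 2^-1) (X 1)) (P 3)))
  (regularM (regularM (X 1) (X 2)) (P 5))).
Qed.

Lemma regular_H (z : 'rV[R]_(6 + 6)) : reg z H.
Proof.
exact: (regularM (regular_cst z 2^-1)
  (regularD (regularX 2 (regular_omega1 z)) (regularX 2 (regular_omega2 z)))).
Qed.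

(** Closed under sums and products, this property holds for every polynomial in H, p3, p4, p5, p6.
    It includes the existence of the partial derivatives of f, so they need not be established
    separately. *)
Definition differential_in_span (z : 'rV[R]_(6 + 6)) (f : 'rV[R]_(6 + 6) -> R) : Prop :=
  exists w1 w2 w3 w4 w5 : R, forall j, is_derive z (delta_mx 0 j) f
    (w1 * partial j H z + w2 * partial j (pc 3) z + w3 * partial j (pc 4) z
     + w4 * partial j (pc 5) z + w5 * partial j (pc 6) z).

Lemma is_derive_partial z f j : reg z f -> is_derive z (delta_mx 0 j) f (partial j f z).
Proof. by move=> [_ df]; exact/derivableP. Qed.

Lemma span_cst z c : differential_in_span z (fun=> c).
Proof.
exists 0, 0, 0, 0, 0 => j; rewrite !mul0r !addr0; exact: is_derive_cst.
Qed.

Lemma spanD z f g : differential_in_span z f -> differential_in_span z g ->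
  differential_in_span z (fun y => f y + g y).
Proof.
move=> [a1 [a2 [a3 [a4 [a5 df]]]]] [b1 [b2 [b3 [b4 [b5 dg]]]]].
exists (a1 + b1), (a2 + b2), (a3 + b3), (a4 + b4), (a5 + b5) => j.
by apply: is_derive_eq (is_deriveD (df j) (dg j)) _; ring.
Qed.

Lemma spanM z f g : differential_in_span z f -> differential_in_span z g ->
  differential_in_span z (fun y => f y * g y).
Proof.
move=> [a1 [a2 [a3 [a4 [a5 df]]]]] [b1 [b2 [b3 [b4 [b5 dg]]]]].
exists (f z * b1 + g z * a1), (f z * b2 + g z * a2), (f z * b3 + g z * a3),
  (f z * b4 + g z * a4), (f z * b5 + g z * a5) => j.
apply: is_derive_eq (is_deriveM (df j) (dg j)) _.
by rewrite -![_ *: _]/(_ * _); ring.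
Qed.

Lemma spanX z f k : differential_in_span z f -> differential_in_span z (fun y => f y ^+ k).
Proof.
move=> sf; elim: k => [|k IH]; first exact: span_cst.
rewrite (_ : (fun y => _) = (fun y => f y * f y ^+ k)); first exact: spanM.
by apply/funext => y; rewrite exprS.
Qed.

Lemma span_sum z (I : Type) (r : seq I) (P : pred I) (f : I -> 'rV[R]_(6 + 6) -> R) :
  (forall i, differential_in_span z (f i)) ->
  differential_in_span z (fun y => \sum_(i <- r | P i) f i y).
Proof.
move=> sf; elim: r => [|i r IH].
  rewrite (_ : (fun y => _) = (fun=> 0)); first exact: span_cst.
  by apply/funext => y; rewrite big_nil.
case Pi: (P i); last first.
  rewrite (_ : (fun y => _) = (fun y => \sum_(i <- r | P i) f i y)) //.
  by apply/funext => y; rewrite big_cons Pi.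
rewrite (_ : (fun y => _) = (fun y => f i y + \sum_(i <- r | P i) f i y)).
  exact: spanD.
by apply/funext => y; rewrite big_cons Pi.
Qed.

Lemma span_H z : differential_in_span z H.
Proof.
exists 1, 0, 0, 0, 0 => j; rewrite !mul0r !addr0 mul1r.
exact: is_derive_partial (regular_H z).
Qed.

Lemma span_pc z : [/\ differential_in_span z (pc 3), differential_in_span z (pc 4),
  differential_in_span z (pc 5) & differential_in_span z (pc 6)].
Proof.
split; [exists 0, 1, 0, 0, 0|exists 0, 0, 1, 0, 0|exists 0, 0, 0, 1, 0|exists 0, 0, 0, 0, 1];
  move=> j; rewrite !mul0r ?addr0 ?add0r mul1r; exact/is_derive_partial/regular_pc.
Qed.

Lemma span_not_row_free z (F : 'rV[R]_(6 + 6) -> R) : differential_in_span z F ->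
  ~~ row_free (gradients (tnth [tuple H; pc 3; pc 4; pc 5; pc 6; F]) z).
Proof.
move=> [w1 [w2 [w3 [w4 [w5 dF]]]]]; apply/negP => /row_free_inj inj.
(* The linear relation between the six gradients; its last entry -1, at the row of F, shows that it
   is nontrivial. *)
pose c : 'rV[R]_6 := \row_i [:: w1; w2; w3; w4; w5; -1]`_i.
have : c = 0.
  apply: inj; rewrite mul0mx; apply/rowP => j; rewrite !mxE.
  rewrite !big_ord_recl big_ord0 !mxE /= !(tnth_nth H) /= addr0.
  have [_ eF] := dF j; rewrite -[partial j F z]/('D_(delta_mx 0 j) F z) eF.
  by ring.
move=> /rowP/(_ ord_max); rewrite !mxE /= => /eqP.
by rewrite oppr_eq0 oner_eq0.
Qed.

Lemma span_near z f g : {near z, f =1 g} -> differential_in_span z g ->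
  differential_in_span z f.
Proof.
move=> fg [w1 [w2 [w3 [w4 [w5 dg]]]]]; exists w1, w2, w3, w4, w5 => j.
apply: near_eq_is_derive (dg j); near do apply/esym.
exact: fg.
Unshelve. all: by end_near. Qed.

End Dependence.

(** * The integral as a polynomial in H, p3, ..., p6 *)

Section NoFinalIntegral.
Context {R : realType}.

Lemma phase_point_exists (x y p q p3 p4 p5 e : R) : exists z : 'rV[R]_(6 + 6),
  [/\ xc 1 z = x, xc 2 z = y, pc 1 z = p & pc 2 z = q] /\
  [/\ pc 3 z = p3, pc 4 z = p4, pc 5 z = p5 & pc 6 z = e].
Proof.
exists (\row_j [:: x; y; 0; 0; 0; 0; p; q; p3; p4; p5; e]`_j).
by split; split; rewrite /xc /pc mxE /= inordK.
Qed.

Variables (d : nat) (a : multiindex d -> 'rV[R]_2 -> R).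
Hypothesis a_smooth : forall t, mlength t = d -> smooth (a t).
Hypothesis commutes : forall z, poisson H (hom_in_momenta a) z = 0.

Let ex (k : nat) (t : multiindex d) : nat := t (inord k).

(* The value of the integral at the origin of the plane, averaged over the
   velocities (r, 0) and (- r, 0) with r ^+ 2 = 2 H. *)
Definition reduced_integral (z : 'rV[R]_(6 + 6)) : R :=
  \sum_t base_coef (pc 3 z) (pc 4 z) (pc 5 z) a t 0 0 *
    ((if odd (ex 0 t) then 0 else (2 * H z) ^+ (ex 0 t)./2) * 0 ^+ ex 1 t
     * pc 6 z ^+ ex 5 t).

(** The speed r is a square root of 2 H, hence not a polynomial in H. Averaging over r and - r
    cancels its odd powers and leaves powers of 2 H. *)
Lemma integral_reduced z : pc 4 z != 0 -> pc 5 z != 0 -> 0 < H z ->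
  hom_in_momenta a z = reduced_integral z.
Proof.
move=> p40 p50 Hz.
have tr e x y p q : magnetic_transport (pc 3 z) (pc 4 z) (pc 5 z) (ex 0) (ex 1) (ex 5)
    (base_coef (pc 3 z) (pc 4 z) (pc 5 z) a)
    (base_coef (pc 3 z) (pc 4 z) (pc 5 z) (fun t => partial ord0 (a t)))
    (base_coef (pc 3 z) (pc 4 z) (pc 5 z) (fun t => partial ord_max (a t))) e x y p q = 0.
  have [z' [[<- <- <- <-] [e3 e4 e5 <-]]] :=
    phase_point_exists x y p q (pc 3 z) (pc 4 z) (pc 5 z) e.
  by rewrite -e3 -e4 -e5 -(poisson_transport a_smooth).
have inv := momentum_function_level_invariant (exp_sum_lt (d := d)) (exp_lt (d := d))
  (is_derive_base_x a_smooth (pc 3 z) (pc 4 z) (pc 5 z))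
  (is_derive_base_y a_smooth (pc 3 z) (pc 4 z) (pc 5 z)) tr p40 p50.
pose r := Num.sqrt (2 * H z).
have r2H : r ^+ 2 = 2 * H z by rewrite /r sqr_sqrtr // mulr_ge0 // ltW.
have r2 : r ^+ 2 = omega1 z ^+ 2 + omega2 z ^+ 2.
  by rewrite r2H /H; field.
have Fz : hom_in_momenta a z = momentum_function (ex 0) (ex 1) (ex 5)
    (base_coef (pc 3 z) (pc 4 z) (pc 5 z) a) (pc 6 z) (xc 1 z) (xc 2 z)
    (omega1 z + gauge1 (pc 3 z) (pc 4 z) (pc 6 z) (xc 1 z) (xc 2 z))
    (omega2 z + gauge2 (pc 3 z) (pc 5 z) (pc 6 z) (xc 1 z) (xc 2 z)).
  by rewrite omega1E omega2E !subrK hom_in_momentaE.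
have pos : 0 < omega1 z ^+ 2 + omega2 z ^+ 2 by rewrite -r2 r2H mulr_gt0.
(* Both potentials vanish at the origin, so there the momenta equal the velocities. *)
have g1 : gauge1 (pc 3 z) (pc 4 z) (pc 6 z) 0 0 = 0 by rewrite /gauge1; ring.
have g2 : gauge2 (pc 3 z) (pc 5 z) (pc 6 z) 0 0 = 0 by rewrite /gauge2; ring.
have at0 s : s ^+ 2 = r ^+ 2 -> hom_in_momenta a z =
    momentum_function (ex 0) (ex 1) (ex 5) (base_coef (pc 3 z) (pc 4 z) (pc 5 z) a)
      (pc 6 z) 0 0 s 0.
  move=> es; rewrite Fz (inv (pc 6 z) _ _ _ _ 0 0 s 0) ?g1 ?g2 ?addr0 //.
  by rewrite es r2; ring.
have e1 := at0 r erefl; have e2 := at0 (- r) (sqrrN r).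
have -> : hom_in_momenta a z = 2^-1 * (hom_in_momenta a z + hom_in_momenta a z) by field.
rewrite {1}e1 e2 /momentum_function /reduced_integral -big_split mulr_sumr.
apply: eq_bigr => t _ /=.
have [odd0|even0] := boolP (odd (ex 0 t)).
  by rewrite exprNn -signr_odd odd0; ring.
rewrite exprNn -signr_odd (negPf even0) -r2H -exprM mul2n.
have -> : (ex 0 t)./2.*2 = ex 0 t by rewrite even_halfK.
by field.
Qed.

Lemma reduced_integral_in_span z : differential_in_span z reduced_integral.
Proof.
have [s3 s4 s5 s6] := span_pc z; have sH := span_H z.
apply: span_sum => t; apply: spanM; last first.
  apply: spanM; last exact: spanX.
  apply: spanM; last exact: span_cst.
  case: odd; first exact: span_cst.
  exact/spanX/spanM/sH/span_cst.
rewrite /base_coef; case: (mlength t == d); last exact: span_cst.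
exact: (spanM (span_cst z _) (spanM (spanM (spanX _ s3) (spanX _ s4)) (spanX _ s5))).
Qed.

Lemma integral_dependent (z : 'rV[R]_(6 + 6)) : (forall i, 1 <= z 0 i <= 2) ->
  ~~ row_free (gradients (tnth [tuple H; pc 3; pc 4; pc 5; pc 6; hom_in_momenta a]) z).
Proof.
move=> z12; apply: span_not_row_free; apply: span_near (reduced_integral_in_span z).
have pk k : 1 <= pc k z by have /andP[] := z12 (rshift 6 (inord k.-1)).
have xk k : 1 <= xc k z by have /andP[] := z12 (lshift 6 (inord k.-1)).
have near_gt0 (f : 'rV[R]_(11.+1) -> R) : {for z, continuous f} -> 0 < f z -> \forall y \near z, 0 < f y.
  by move=> cf fz; exact: (cvgr_gt (f z) cf).
have p4 : \forall y \near z, 0 < pc 4 y.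
  by apply: near_gt0; [have [] := regular_pc 4 z|rewrite (lt_le_trans _ (pk 4))].
have p5 : \forall y \near z, 0 < pc 5 y.
  by apply: near_gt0; [have [] := regular_pc 5 z|rewrite (lt_le_trans _ (pk 5))].
have Hn : \forall y \near z, 0 < H y.
  apply: near_gt0; first by have [] := regular_H z.
  (* All terms of [omega2] are positive when the coordinates are at least 1, whereas those of
     [omega1] have mixed signs. *)
  rewrite /H mulr_gt0 // ltr_wpDl ?sqr_ge0 // exprn_gt0 // /omega2.
  have := pk 2; have := pk 3; have := pk 5; have := xk 1; have := xk 2.
  move=> h1 h2 h3 h4 h5; rewrite !addr_gt0 ?mulr_gt0 //; lra.
near=> y; apply: integral_reduced; last by near: y.
- by rewrite gt_eqF //; near: y.
- by rewrite gt_eqF //; near: y.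
Unshelve. all: by end_near. Qed.

End NoFinalIntegral.

Theorem theorem1 (R : realType) (d : nat) (hd : (1 <= d <= 6)%N) :
  ~ exists F : 'rV[R]_(6 + 6) -> R, final_integral d F.
Proof.
move=> [F [[a [a_smooth Fa]] commutes indep]].
have {Fa} eF : F = hom_in_momenta a by apply/funext.
move: indep; rewrite /functionally_independent_ae; apply: cube_not_null => z z12.
rewrite /= eF; apply: integral_dependent => // z'.
by rewrite -eF.
Qed.
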